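(* Let $r\ge 1$. Let $\ell_\beta,m_\beta\ge 1$ be integer-valued functions of $\beta\in(0,1)$, put $\alpha_{1,\beta}=\beta+(1-\varrho_{1,\beta})^{m_\beta+1}$, $\alpha_{2,\beta}=\dfrac{\beta(1-\varrho_{2,\beta})^{\ell_\beta+m_\beta}}{1+\beta}$, $k^*_\beta=\ell_\beta+m_\beta$, and assume that $$\lim_{\beta\to0}\frac{|\log\alpha_{1,\beta}|}{|\log\beta|}=1,\qquad \lim_{\beta\to0}\frac{|\log\alpha_{2,\beta}|}{|\log\beta|}=1,\qquad \lim_{\beta\to0}\alpha_{2,\beta}\,\varrho_{2,\beta}\,k^*_\beta=0 .$$ Let $T_\beta=T_{a_\beta}$ be the weighted Shiryaev--Roberts procedure with threshold $a_\beta=\log\dfrac{1-\alpha_{2,\beta}}{\varrho_{2,\beta}\,\alpha_{2,\beta}}$. Then for every $0<\beta<1$ the procedure $T_\beta$ belongs to the class $\mathcal H(\beta,\ell_\beta,m_\beta)$. Assume in addition that there is a positive continuous function $I:\Theta\to\mathbb R$, $\theta\mapsto I_\theta$, such that: (1) for all $k\ge0$, $\varepsilon>0$, $\theta\in\Theta$: $\displaystyle\lim_{N\to\infty}\mathsf P_{k,\theta}\Big(\frac1N\max_{1\le n\le N}Z^k_{k+n}(\theta)\ge(1+\varepsilon)I_\theta\Big)=0$; (2) for all $\theta\in\Theta$ and $\varepsilon>0$: $\displaystyle\lim_{\delta\to0}\sum_{n=1}^\infty n^{r-1}\sup_{\nu\ge0}\mathsf P_{\nu,\theta}\Big(\frac1n\inf_{u\in\Theta,\,|u-\theta|<\delta}Z^\nu_{\nu+n}(u)<I_\theta-\varepsilon\Big)<\infty$.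 Then, as $\beta\to0$, for every $\theta\in\Theta$ and every fixed $\nu\in\{0,1,2,\dots\}$, $$\inf_{\tau\in\mathcal H(\beta,\ell_\beta,m_\beta)}\mathcal R^r_{\nu,\theta}(\tau)\sim\Big(\frac{|\log\beta|}{I_\theta}\Big)^r\sim\mathcal R^r_{\nu,\theta}(T_\beta),$$ and for every $\theta\in\Theta$ $$\inf_{\tau\in\mathcal H(\beta,\ell_\beta,m_\beta)}\max_{0\le\nu\le k^*_\beta}\mathcal R^r_{\nu,\theta}(\tau)\sim\Big(\frac{|\log\beta|}{I_\theta}\Big)^r\sim\max_{0\le\nu\le k^*_\beta}\mathcal R^r_{\nu,\theta}(T_\beta).$$ Thus $T_\beta$ is first-order asymptotically pointwise optimal and minimax in the class $\mathcal H(\beta,\ell_\beta,m_\beta)$, minimizing moments of the detection delay up to order $r$ (i.e. these relations hold for every order in $[1,r]$) for all $\theta\in\Theta$.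
   Context: Model. $X_1,X_2,\dots$ are observations, $\mathbf X^n=(X_1,\dots,X_n)$, $\mathcal F_n=\sigma(X_1,\dots,X_n)$. $\Theta$ is a parameter set in a Euclidean space with norm $|\cdot|$. For each $i\ge1$, $\psi_i(X_i|\mathbf X^{i-1})$ (pre-change) and $f_{\theta,i}(X_i|\mathbf X^{i-1})$, $\theta\in\Theta$ (post-change; it may also depend on the change point $\nu$) are conditional densities of $X_i$ given $\mathbf X^{i-1}$ with respect to some non-degenerate $\sigma$-finite measure. For $\nu\in\{0,1,2,\dots\}$ and $\theta\in\Theta$, $\mathsf P_{\nu,\theta}$ is the measure under which $\mathbf X^n$ has density $\prod_{i=1}^n\psi_i(X_i|\mathbf X^{i-1})$ for $n\le\nu$ and $\prod_{i=1}^{\nu}\psi_i(X_i|\mathbf X^{i-1})\prod_{i=\nu+1}^nf_{\theta,i}(X_i|\mathbf X^{i-1})$ for $n>\nu$ ($X_\nu$ is the last pre-change observation); $\mathsf P_\infty$ is the measure with no change (density $\prod_{i=1}^n\psi_i$ for all $n$). $\mathsf E_{\nu,\theta},\mathsf E_\infty$ are the expectations. Log-likelihood ratio: $Z^k_n(\theta)=\sum_{j=k+1}^n\log\frac{f_{\theta,j}(X_j|\mathbf X^{j-1})}{\psi_j(X_j|\mathbf X^{j-1})}$, $n\ge k+1$. Procedure. $W$ is a probability distribution on $\Theta$ with $W\{u\in\Theta:|u-\theta|<\delta\}>0$ for all $\delta>0$, $\theta\in\Theta$. The weighted Shiryaev--Roberts (WSR) statistic is $R^W_n=\int_\Theta\sum_{k=1}^n\prod_{i=k}^n\frac{f_{\theta,i}(X_i|\mathbf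 X^{i-1})}{\psi_i(X_i|\mathbf X^{i-1})}\,dW(\theta)$, $n\ge1$, $R^W_0=0$, and the WSR procedure is $T_a=\inf\{n\ge1:\log R^W_n\ge a\}$, with $\inf\varnothing=+\infty$. Risk and class. $\mathcal M$ is the set of all (extended) stopping times of $(\mathcal F_n)$. $\mathcal R^r_{\nu,\theta}(\tau)=\mathsf E_{\nu,\theta}[(\tau-\nu)^r\mid\tau>\nu]$. For $0<\beta<1$ and integers $\ell,m\ge1$, $\mathcal H(\beta,\ell,m)=\{\tau\in\mathcal M:\sup_{1\le k\le\ell}\mathsf P_\infty(\tau<k+m\mid\tau\ge k)\le\beta\}$. Auxiliary functions. $\varrho_{1,\beta}\in(0,1)$ and $\check\delta_\beta\in(0,1)$ are functions of $\beta$ with $\lim_{\beta\to0}(\varrho_{1,\beta}+\check\delta_\beta)=0$ and $\lim_{\beta\to0}\frac{|\log\varrho_{1,\beta}|+|\log\check\delta_\beta|}{|\log\beta|}=0$; $\varrho_{2,\beta}=\check\delta_\beta\,\varrho_{1,\beta}$. $b\sim\tilde b$ means that the ratio tends to $1$. *)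

(* Defs.v *)
From HB Require Import structures.
From mathcomp Require Import all_boot all_order all_algebra.
From mathcomp Require Import all_classical all_reals all_analysis.

Set Implicit Arguments.
Unset Strict Implicit.
Unset Printing Implicit Defensive.

Import Order.TTheory GRing.Theory Num.Theory.
Import numFieldNormedType.Exports.

Local Open Scope classical_set_scope.
Local Open Scope ring_scope.
Local Open Scope ereal_scope.

(* The library norm of 'rV[R]_p is the max norm. *)
Definition enorm (R : realType) (p : nat) (u : 'rV[R]_p) : R :=
  Num.sqrt (\sum_(i < p) u ord0 i ^+ 2)%R.

(* R^p with the sigma-algebra generated by the open sets and Theta itself: its
   trace on Theta is the Borel sigma-algebra of Theta, and a probability W on
   it with W Theta = 1 is a Borel probability on Theta, for an arbitrary (not
   necessarily Borel) set Theta. *)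
Definition param_space (R : realType) (p : nat) (Theta : set 'rV[R]_p) :=
  g_sigma_algebraType (@open 'rV[R]_p `|` [set Theta]).

(* Indices are shifted by one throughout: obs j is X_{j+1}, and a sequence
   g of conditional densities has g j t x = g_{j+1}(x | t) where t : j.-tuple E
   is the past X_1, ..., X_j. *)

Section Densities.
Context (R : realType) (d : measure_display) (E : measurableType d).

Definition prefix_tuple n (x : n.-tuple E) (j : 'I_n) : j.-tuple E :=
  [tuple tnth x (widen_ord (ltnW (ltn_ord j)) i) | i < j].

Definition joint_density (g : forall j : nat, j.-tuple E -> E -> R)
    (n : nat) (x : n.-tuple E) : R :=
  (\prod_(j < n) g j (prefix_tuple x j) (tnth x j))%R.

(* Integral with respect to mu_1 (x) ... (x) mu_n, as an iterated integral. *)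
Fixpoint iterated_integral (mu : nat -> {sigma_finite_measure set E -> \bar R})
    (n : nat) : (n.-tuple E -> \bar R) -> \bar R :=
  match n with
  | 0%N => fun h => h [tuple]
  | n'.+1 => fun h => iterated_integral mu
      (fun t : n'.-tuple E => \int[mu n']_x h [tuple of rcons t x])
  end.

Definition cond_densities (mu : nat -> {sigma_finite_measure set E -> \bar R})
    (g : forall j : nat, j.-tuple E -> E -> R) : Prop :=
  forall j : nat,
    [/\ forall t x, (0 <= g j t x)%R,
        measurable_fun [set: j.-tuple E * E] (fun z => g j z.1 z.2) &
        forall t, \int[mu j]_x (g j t x)%:E = 1].

End Densities.

Section Histories.
Context (d d' : measure_display) (T : measurableType d) (E : measurableType d').

Definition history (X : nat -> T -> E) (n : nat) (w : T) : n.-tuple E :=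
  [tuple X i w | i < n].

Definition has_density (R : realType)
    (mu : nat -> {sigma_finite_measure set E -> \bar R})
    (X : nat -> T -> E) (g : forall j : nat, j.-tuple E -> E -> R)
    (P : set T -> \bar R) : Prop :=
  forall (n : nat) (B : set (n.-tuple E)), measurable B ->
    P (history X n @^-1` B) =
    iterated_integral mu (fun x => (\1_B x * joint_density g x)%:E).

(* sigma(X_1, ..., X_n) *)
Definition natural_filtration (X : nat -> T -> E) (n : nat) : set (set T) :=
  g_sigma_preimage (fun i : 'I_n => X i).

End Histories.

Record changepoint_model (R : realType) (d d' : measure_display)
    (T : measurableType d) (E : measurableType d') (p : nat)
    (Theta : set 'rV[R]_p) := ChangepointModel {
  obs : nat -> T -> E ;
  dom : nat -> {sigma_finite_measure set E -> \bar R} ;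
  pre : forall j : nat, j.-tuple E -> E -> R ;
  (* post nu theta j : post-change density when the change point is nu *)
  post : nat -> 'rV[R]_p -> forall j : nat, j.-tuple E -> E -> R ;
  Pinf : probability T R ;
  Pchange : nat -> 'rV[R]_p -> probability T R ;
  obs_measurable : forall j, measurable_fun [set: T] (obs j) ;
  dom_nondegenerate : forall j, dom j [set: E] != 0 ;
  pre_density : cond_densities dom pre ;
  post_density : forall nu theta, Theta theta ->
    cond_densities dom (post nu theta) ;
  (* joint measurability in the parameter, needed to integrate over Theta *)
  post_measurable : forall nu j,
    measurable_fun
      (Theta `*` setT : set (param_space Theta * (j.-tuple E * E)))
      (fun z => post nu z.1 z.2.1 z.2.2) ;
  Pinf_density : has_density dom obs pre Pinf ;
  Pchange_density : forall nu theta, Theta theta ->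
    has_density dom obs
      (fun j => if (j < nu)%N then @pre j else @post nu theta j)
      (Pchange nu theta)
}.

Section Procedures.
Context (R : realType) (d d' : measure_display) (T : measurableType d)
  (E : measurableType d') (p : nat) (Theta : set 'rV[R]_p)
  (M : changepoint_model T E Theta).

(* f_{theta,j+1}(X_{j+1}|X^j) / psi_{j+1}(X_{j+1}|X^j), with change point k.
   Division, products, sums and logarithms are those of \bar R:
   x / 0 = +oo for x > 0, 0 / 0 = 0, 0 * +oo = 0, lne 0 = -oo and
   -oo + +oo = -oo, so that lne turns products of ratios into sums. *)
Definition lr (k : nat) (theta : 'rV[R]_p) (j : nat) (w : T) : \bar R :=
  (post M k theta (history (obs M) j w) (obs M j w))%:E /
  (pre M (history (obs M) j w) (obs M j w))%:E.

Definition llr (k n : nat) (theta : 'rV[R]_p) (w : T) : \bar R :=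
  \sum_(k <= j < n) lne (lr k theta j w).

(* The k-th summand, 0 <= k < n, corresponds to the change point k, i.e. to
   X_{k+1} being the first post-change observation. *)
Definition wsr (W : probability (param_space Theta) R) (n : nat) (w : T)
    : \bar R :=
  \int[W]_(theta in (Theta : set (param_space Theta)))
    \sum_(0 <= k < n) \prod_(k <= j < n) lr k theta j w.

Definition wsr_time (W : probability (param_space Theta) R) (a : R) (w : T)
    : \bar R :=
  ereal_inf [set (n%:R)%:E | n in
    [set n : nat | (1 <= n)%N /\ a%:E <= lne (wsr W n w)]].

Definition stopping_time (tau : T -> \bar R) : Prop :=
  (forall w, tau w = +oo \/ exists n : nat, tau w = (n%:R)%:E) /\
  (forall n : nat,
    natural_filtration (obs M) n [set w | tau w <= (n%:R)%:E]).

(* The conditional probabilities are required to be defined; this only rules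
   out tau = 0 identically. *)
Definition class_H (beta : R) (l m : nat) : set (T -> \bar R) :=
  [set tau | [/\ stopping_time tau,
     forall k : nat, (1 <= k <= l)%N ->
       0 < Pinf M [set w | (k%:R)%:E <= tau w] &
     ereal_sup [set Pinf M ([set w | tau w < ((k + m)%:R)%:E] `&`
                            [set w | (k%:R)%:E <= tau w]) /
                    Pinf M [set w | (k%:R)%:E <= tau w]
               | k in [set k : nat | (1 <= k <= l)%N]] <= beta%:E]].

(* Equal to 0 when the conditioning event has probability 0; for tau in
   class_H beta l m, beta < 1, this can only occur when nu >= l + m. *)
Definition risk (r : R) (nu : nat) (theta : 'rV[R]_p) (tau : T -> \bar R)
    : \bar R :=
  (\int[Pchange M nu theta]_(w in [set w | (nu%:R)%:E < tau w])
     (tau w - (nu%:R)%:E) `^ r) /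
  Pchange M nu theta [set w | (nu%:R)%:E < tau w].

Definition max_risk (r : R) (K : nat) (theta : 'rV[R]_p) (tau : T -> \bar R)
    : \bar R :=
  \big[maxe/-oo]_(0 <= nu < K.+1) risk r nu theta tau.

Definition condition1 (I : 'rV[R]_p -> R) : Prop :=
  forall (k : nat) (eps : R) (theta : 'rV[R]_p), (0 < eps)%R -> Theta theta ->
    (fun N : nat => Pchange M k theta
       [set w | ((1 + eps) * I theta)%:E <=
          (N%:R^-1)%:E * \big[maxe/-oo]_(1 <= n < N.+1) llr k (k + n) theta w])
    @ \oo --> 0.

(* The infimum over u is uncountable, so the event need not be measurable:
   its probability is the outer probability mu_ext, which coincides with the
   probability on measurable sets. The sum is monotone in delta. *)
Definition condition2 (r : R) (I : 'rV[R]_p -> R) : Prop :=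
  forall (theta : 'rV[R]_p) (eps : R), Theta theta -> (0 < eps)%R ->
    lim ((\sum_(1 <= n <oo) ((n%:R `^ (r - 1))%R)%:E *
           ereal_sup (range (fun nu : nat => mu_ext (Pchange M nu theta)
             [set w | (n%:R^-1)%:E *
                ereal_inf [set llr nu (nu + n) u w | u in
                  [set u | Theta u /\ (enorm (u - theta) < delta)%R]]
                < (I theta - eps)%:E])))
         @[delta --> 0%R^'+]) < +oo.

End Procedures.

(* b ~ c as beta -> 0, beta > 0 *)
Definition equiv0 (R : realType) (b c : R -> \bar R) : Prop :=
  (b beta / c beta) @[beta --> 0%R^'+] --> 1.

(* Main.v *)
Require Import Defs.
From HB Require Import structures.
From mathcomp Require Import all_boot all_order all_algebra.
From mathcomp Require Import all_classical all_reals all_analysis.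
From mathcomp Require Import measurable_realfun ring lra.

Set Implicit Arguments.
Unset Strict Implicit.
Unset Printing Implicit Defensive.

Import Order.TTheory GRing.Theory Num.Theory.
Import numFieldNormedType.Exports.

Local Open Scope classical_set_scope.
Local Open Scope ring_scope.

(** The proof rests on comparing the pre-change law Pinf and the post-change
laws on events of the past sigma(X_1, ..., X_n), where the likelihood ratio is
bounded ([change_of_measure]); up to the change point the two laws agree
([Pchange_past]).

False alarms. The Pinf-expectation of the likelihood ratio
Lambda_{k,j}(theta) on an event of the past at time j is at most the
probability of that event under the change point k. On the event that the
procedure T_a stops at time j the statistic R_j = int sum_{k<j} Lambda_{k,j} dW
is at least e^a, so by Tonelli, summing over j <= n,

  e^a Pinf(T_a <= n) <= sum_{k<n} int P_{k,theta}(T_a <= n) dW(theta) <= n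

([wsr_false_alarm]). For the prescribed threshold, Bernoulli's inequality
(1 - rho)^K (1 + K rho) <= 1 turns this into membership in the class
([wsr_class_H]).

Lower bound. For tau in the class the constraint at k = 1 reads
Pinf(tau <= m) <= beta, because nothing is observed at time 0
([class_H_early]), and the assumption on alpha_1 forces m / |log beta| to
infinity ([window_length_growth]). Take N slightly smaller than
|log beta| / I_theta. Stopping in (nu, nu + N] under P_{nu,theta} requires
either a log-likelihood ratio at time nu + N above (1 + eps) I_theta N, which is
unlikely by the first condition, or an event of Pinf-probability at most beta,
which the change of measure inflates by at most
e^((1 + eps) I_theta N) = o(1 / beta) ([Pchange_detect_le]). Hence the delay
exceeds N with probability close to 1 ([class_risk_lower]). The choice nu = 0
gives the minimax lower bound.

Upper bound. If the log-likelihood ratio has grown at rate J < I_theta at every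
parameter of a small ball B around theta, then R_{nu+n} >= e^(n J) W(B), so T_a
has stopped by nu + n as soon as n J + log W(B) >= a. The tail of the delay
beyond N_0, which is close to a / J, is therefore controlled by the series of
the second condition, and the q-th moment of the delay is at most N_0^q plus a
constant, uniformly in nu ([wsr_risk_le]). As a is asymptotically |log beta| and
Pinf(T_a <= nu) tends to 0 uniformly in nu <= k*, the risk is at most
(1 + o(1)) (|log beta| / I_theta)^q for all nu <= k* ([wsr_risk_upper]). *)


(** * Domination of integrals *)

Section MeasureTheory.
Local Open Scope ereal_scope.
Context (R : realType) (d : measure_display) (S : measurableType d).
Import HBNNSimple.

(** The integral of a nonnegative function is the supremum of the integrals of
the simple functions below it, and scaling by c maps the simple functions below
f to simple functions below g. The bound thus holds for arbitrary functions, such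
as the inner integrals of an iterated integral. *)
Lemma ge0_scale_integral_le (mu : {measure set S -> \bar R}) (D : set S)
    (c : R) (f g : S -> \bar R) :
  (0 <= c)%R -> (forall x, D x -> 0 <= f x) ->
  (forall x, D x -> c%:E * f x <= g x) ->
  c%:E * \int[mu]_(x in D) f x <= \int[mu]_(x in D) g x.
Proof.
move=> c0 f0 fg.
have g0 x : D x -> 0 <= g x.
  by move=> Dx; apply: le_trans (fg _ Dx); rewrite mule_ge0 ?lee_fin ?f0.
have [->|cn0] := eqVneq c 0%R; first by rewrite mul0e integral_ge0.
have cp : (0 < c)%R by rewrite lt_neqAle eq_sym cn0.
rewrite -lee_pdivlMl// (ge0_integralE _ f0); apply: ge_ereal_sup => _ [h hf <-].
rewrite lee_pdivlMl// ge0_integralE//; apply: ereal_sup_ubound.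
exists (scale_nnsfun h c0); last first.
  by rewrite sintegralrM.
move=> x /=; rewrite patchE; case: ifPn => [/set_mem Dx|nDx].
  apply: le_trans (fg _ Dx); rewrite EFinM lee_pmul2l//.
  by apply: le_trans (hf x) _; rewrite patchE mem_set.
have := hf x; rewrite patchE (negbTE nDx) lee_fin => hx.
by rewrite lee_fin mulr_ge0_le0.
Qed.

(** For a simple function h below phi, each level set of h with value c is an
event on which phi >= c; the hypothesis bounds each term of the integral of h,
and the level sets are disjoint. *)
Lemma ge0_integral_le_measure (mu nu : {measure set S -> \bar R}) (A : set S)
    (phi : S -> \bar R) :
  measurable A -> (forall x, A x -> 0 <= phi x) ->
  (forall (c : R) (B : set S), (0 <= c)%R -> measurable B -> B `<=` A ->
     (forall x, B x -> c%:E <= phi x) -> c%:E * mu B <= nu B) ->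
  \int[mu]_(x in A) phi x <= nu A.
Proof.
move=> mA phi0 H; rewrite ge0_integralE//.
apply: ge_ereal_sup => _ [h hphi <-]; rewrite sintegralE.
pose B (y : R) := A `&` h @^-1` [set y].
have mh y : measurable (h @^-1` [set y]) by exact: measurable_sfunP.
have mB y : measurable (B y) by apply: measurableI.
have h0A x : ~ A x -> h x = 0%R.
  move=> nAx; have := hphi x; rewrite patchE memNset// lee_fin => hx.
  by apply/eqP; rewrite eq_le hx/= fun_ge0.
apply: (@le_trans _ _ (\sum_(y \in range h) nu (B y))).
  rewrite !fsbig_finite//= big_seq [leRHS]big_seq; apply: lee_sum => y.
  rewrite in_fset_set// inE => -[x _ <-].
  have [->|hx0] := eqVneq (h x) 0%R; first by rewrite mul0e.
  have -> : h @^-1` [set h x] = B (h x).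
    apply/seteqP; split=> [z /= hz|z []//]; split=> //.
    by apply: contrapT => /h0A; rewrite hz; apply/eqP.
  apply: H => //.
    by move=> z [].
  move=> z [Az /= <-]; apply: le_trans (hphi z) _; by rewrite patchE mem_set.
rewrite -measure_fin_bigcup//; first last.
  by move=> y1 y2 _ _ [z [[_ /= <-] [_ /= <-]]].
apply: le_measure; rewrite ?inE//.
  by apply: fin_bigcup_measurable.
by move=> z [y _ []].
Qed.
End MeasureTheory.

(** * Iterated integrals, the natural filtration and change of measure *)

Section IteratedIntegral.
Local Open Scope ereal_scope.
Context (R : realType) (d : measure_display) (E : measurableType d).
Context (mu : nat -> {sigma_finite_measure set E -> \bar R}).

Lemma scale_iterated_integral_le n (c : R) (h h' : n.-tuple E -> \bar R) :
  (0 <= c)%R -> (forall t, 0 <= h t) -> (forall t, c%:E * h t <= h' t) ->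
  c%:E * iterated_integral mu h <= iterated_integral mu h'.
Proof.
move=> c0; elim: n h h' => [|n IHn] h h' h0 hh' /=; first exact: hh'.
apply: IHn => t; first by apply: integral_ge0 => x _; exact: h0.
by apply: ge0_scale_integral_le => [|x _|x _]; [exact: c0|exact: h0|exact: hh'].
Qed.

End IteratedIntegral.

Section Past.
Context (d d' : measure_display) (T : measurableType d) (E : measurableType d').
Context (X : nat -> T -> E).

(** T with the events of sigma(X_1, ..., X_n) as its only measurable sets, so
that adaptedness at time n is measurability in the ordinary sense and Tonelli's
theorem yields adapted integrals. *)
Definition past (n : nat) := g_sigma_algebraType (natural_filtration X n).

Lemma natural_filtrationE n :
  natural_filtration X n = preimage_set_system setT (history X n) measurable.
Proof.
rewrite -(@g_sigma_preimage_comp _ E n (n.-tuple E) (fun i t => tnth t i)).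
congr (g_sigma_preimage _); apply/funext => i; apply/funext => w /=.
by rewrite tnth_mktuple.
Qed.

(** Writes an event of the past as a cylinder, the form in which [has_density]
gives its probability. *)
Lemma natural_filtrationP n (A : set T) :
  natural_filtration X n A <->
  exists2 B : set (n.-tuple E), measurable B & history X n @^-1` B = A.
Proof.
rewrite natural_filtrationE; split => -[B mB <-]; exists B => //.
all: by rewrite setTI.
Qed.

Lemma measurable_past n (A : set (past n)) :
  measurable A <-> natural_filtration X n A.
Proof.
rewrite /measurable/= -[X in <<s X >>]/(natural_filtration X n).
by rewrite sigma_algebra_id//; exact: smallest_sigma_algebra.
Qed.

Lemma measurable_history_past n k : (k <= n)%N ->
  measurable_fun [set: past n] (history X k : past n -> k.-tuple E).
Proof.
move=> kn; apply/measurable_fun_tnthP => i.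
have mn : measurable_fun [set: past n] (history X n : past n -> n.-tuple E).
  move=> _ B mB; rewrite setTI; apply/measurable_past/natural_filtrationP.
  by exists B.
have := measurableT_comp (measurable_tnth (widen_ord kn i)) mn.
apply: eq_measurable_fun => w _ /=.
by rewrite !tnth_mktuple.
Qed.

Lemma measurable_obs_past n j : (j < n)%N ->
  measurable_fun [set: past n] (X j : past n -> E).
Proof.
move=> jn; have /measurable_fun_tnthP/(_ ord_max) := measurable_history_past jn.
by apply: eq_measurable_fun => w _ /=; rewrite tnth_mktuple.
Qed.

Context (mX : forall j, measurable_fun setT (X j)).

Lemma measurable_history n : measurable_fun setT (history X n).
Proof.
apply/measurable_fun_tnthP => i; apply: eq_measurable_fun (mX i) => w _ /=.
by rewrite tnth_mktuple.
Qed.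

Lemma measurable_id_past n : measurable_fun [set: T] (id : T -> past n).
Proof.
move=> _ A /measurable_past/natural_filtrationP[B mB <-].
rewrite setTI preimage_id -[X in measurable X]setTI.
exact: measurable_history.
Qed.

Lemma natural_filtration_measurable n (A : set T) :
  natural_filtration X n A -> measurable A.
Proof.
by move=> /measurable_past/(measurable_id_past measurableT); rewrite setTI.
Qed.

End Past.
Arguments past {d d' T E} X n.
Arguments measurable_history_past {d d' T E} X {n k}.
Arguments measurable_obs_past {d d' T E} X {n j}.

Section JointDensity.
Local Open Scope ereal_scope.
Context (R : realType) (d d' : measure_display) (T : measurableType d)
  (E : measurableType d').
Context (mu : nat -> {sigma_finite_measure set E -> \bar R})
  (X : nat -> T -> E).

Lemma joint_density_history (g : forall j : nat, j.-tuple E -> E -> R) n w :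
  joint_density g (history X n w) = (\prod_(j < n) g j (history X j w) (X j w))%R.
Proof.
apply: eq_bigr => j _; rewrite tnth_mktuple; congr (g j _ _).
by apply: eq_from_tnth => i; rewrite !tnth_mktuple.
Qed.

Lemma joint_density_ge0 g n (x : n.-tuple E) :
  cond_densities mu g -> (0 <= joint_density g x)%R.
Proof. by move=> dg; apply: prodr_ge0 => j _; have [g0 _ _] := dg j; exact: g0. Qed.

Lemma measurable_joint_density (g : forall j : nat, j.-tuple E -> E -> R) n :
  cond_densities mu g ->
  measurable_fun [set: n.-tuple E] (fun x => joint_density g x).
Proof.
move=> dg; apply: measurable_prod => j _.
have [_ mg _] := dg j.
have mp : measurable_fun [set: n.-tuple E]
    (fun x => (prefix_tuple x j, tnth x j)).
  apply: measurable_fun_pair; last exact: measurable_tnth.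
  apply/measurable_fun_tnthP => i.
  apply: eq_measurable_fun (measurable_tnth (widen_ord (ltnW (ltn_ord j)) i)).
  by move=> x _ /=; rewrite tnth_mktuple.
exact: (measurableT_comp mg mp).
Qed.

(** The comparison of the densities is known only at the tuples that occur as
histories, whereas the iterated integral runs over all tuples; B is therefore
cut down to the measurable set D of the tuples at which the comparison holds,
which does not change the event. *)
Lemma change_of_measure g g' (P P' : probability T R) n (c : R) (A : set T) :
  cond_densities mu g -> cond_densities mu g' ->
  has_density mu X g P -> has_density mu X g' P' ->
  (0 <= c)%R -> natural_filtration X n A ->
  (forall w, A w -> c * joint_density g (history X n w) <=
                    joint_density g' (history X n w))%R ->
  c%:E * P A <= P' A.
Proof.
move=> dg dg' Pg Pg' c0 /natural_filtrationP[B mB <-] cgg'.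
pose D := B `&` [set x | (c * joint_density g x <= joint_density g' x)%R].
have mD : measurable D.
  apply: measurableI => //; rewrite -[X in measurable X]setTI.
  apply: measurable_fun_le; first by [].
    by apply: measurable_funM => //; exact: measurable_joint_density dg.
  exact: measurable_joint_density dg'.
have -> : history X n @^-1` B = history X n @^-1` D.
  by apply/seteqP; split=> [w Bw|w []//]; split=> //; exact: cgg'.
rewrite Pg// Pg'//; apply: scale_iterated_integral_le => // x.
  by rewrite lee_fin mulr_ge0// (joint_density_ge0 _ dg).
rewrite -EFinM lee_fin indicE; case: (boolP (x \in D)); last by rewrite !mul0r mulr0.
by rewrite inE => -[_ /= ?]; rewrite !mul1r.
Qed.

End JointDensity.

(** * Products of ratios of densities *)

Section RatioProducts.
Local Open Scope ereal_scope.
Context (R : realType).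
Implicit Types (f p : nat -> R) (s : seq nat).

Lemma ratio_ge0 (x y : R) : (0 <= x)%R -> (0 <= y)%R -> 0 <= x%:E / y%:E.
Proof. by move=> x0 y0; rewrite mule_ge0 ?inve_ge0 ?lee_fin. Qed.

(** Only an inequality: a factor with p j = 0 < f j contributes oo * 0 = 0 on the
left, where the part of the numerator law that is singular to the denominator
law is lost. *)
Lemma prod_ratio_mul_le f p s :
  (forall j, 0 <= f j)%R -> (forall j, 0 <= p j)%R ->
  (\prod_(j <- s) ((f j)%:E / (p j)%:E)) * (\prod_(j <- s) p j)%:E
    <= (\prod_(j <- s) f j)%:E.
Proof.
move=> f0 p0; elim: s => [|j s IHs]; first by rewrite !big_nil mule1.
rewrite !big_cons !EFinM muleACA.
apply: lee_pmul IHs.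
- by rewrite mule_ge0 ?lee_fin// ratio_ge0.
- rewrite mule_ge0 ?lee_fin ?prodr_ge0//.
  by apply: prode_ge0 => i _; exact: ratio_ge0.
have [->|pj0] := eqVneq (p j) 0%R; first by rewrite mule0 lee_fin.
by rewrite inver (negbTE pj0) -!EFinM -mulrA mulVf// mulr1.
Qed.

(** When all numerators are positive, a vanishing denominator would make the
product of the ratios infinite; a finite bound on it excludes this, and the
quotient is then an ordinary one. *)
Lemma prod_le_of_ratio_le f p s (c : R) :
  (forall j, 0 <= f j)%R -> (forall j, 0 <= p j)%R ->
  \prod_(j <- s) ((f j)%:E / (p j)%:E) <= c%:E ->
  (\prod_(j <- s) f j <= c * \prod_(j <- s) p j)%R.
Proof.
move=> f0 p0 pc.
have c0 : (0 <= c)%R.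
  rewrite -lee_fin; apply: le_trans pc.
  by apply: prode_ge0 => j _; exact: ratio_ge0.
have P0 : (0 <= \prod_(j <- s) p j)%R by exact: prodr_ge0.
have [fs|] := boolP (all (fun j => f j != 0)%R s); last first.
  rewrite -has_predC => /hasP[j js /= /negPn/eqP fj0].
  rewrite (_ : (\prod_(j <- s) f j)%R = 0%R); first exact: mulr_ge0.
  by apply/eqP; rewrite prodf_seq_eq0; apply/hasP; exists j => //=; exact/eqP.
suff [fp [Poo|[pp Peq]]] : (0 < \prod_(j <- s) f j)%R /\
    (\prod_(j <- s) ((f j)%:E / (p j)%:E) = +oo \/
    (0 < \prod_(j <- s) p j)%R /\ \prod_(j <- s) ((f j)%:E / (p j)%:E) =
       ((\prod_(j <- s) f j) / \prod_(j <- s) p j)%:E).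
  - by move: pc; rewrite Poo.
  - by move: pc; rewrite Peq lee_fin ler_pdivrMr.
elim: s {pc P0} fs => [|j s IHs] /=; first by rewrite !big_nil divr1; split; [|right].
move=> /andP[fj0 /IHs[fp {}IHs]]; rewrite !big_cons.
have fj : (0 < f j)%R by rewrite lt_neqAle eq_sym fj0 f0.
split; first exact: mulr_gt0.
have [pj0|pj0] := eqVneq (p j) 0%R.
  left; rewrite pj0 inver eqxx gt0_muley ?lte_fin//.
  case: IHs => [->|[pp ->]]; first by rewrite mulyy.
  by rewrite gt0_mulye// lte_fin divr_gt0.
have pj : (0 < p j)%R by rewrite lt_neqAle eq_sym pj0 p0.
rewrite inver (negbTE pj0); case: IHs => [->|[pp ->]].
  by left; rewrite gt0_muley// -EFinM lte_fin divr_gt0.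
right; split; first exact: mulr_gt0.
by rewrite -!EFinM invfM mulrACA.
Qed.
End RatioProducts.

Lemma emeasurable_prod (R : realType) d (S : measurableType d) (D : set S)
    (I : eqType) (s : seq I) (h : I -> S -> \bar R) :
  (forall i, i \in s -> measurable_fun D (h i)) ->
  measurable_fun D (fun x => \prod_(i <- s) h i x)%E.
Proof.
elim: s => [|i s IHs] mh.
  by under eq_fun do rewrite big_nil; exact: measurable_cst.
under eq_fun do rewrite big_cons; apply: emeasurable_funM.
  by apply: mh; rewrite mem_head.
by apply: IHs => j js; apply: mh; rewrite inE js orbT.
Qed.

(** For a nonnegative real the extended inverse is +oo at 0 and the power with
exponent -1 elsewhere. *)
Lemma measurable_inve_ge0 (R : realType) d (S : measurableType d) (D : set S)
    (p : S -> R) :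
  (forall x, 0 <= p x) -> measurable_fun D p ->
  measurable_fun D (fun x => ((p x)%:E^-1)%E).
Proof.
move=> p0 mp.
pose h (y : R) := if y == 0%R then +oo%E else (y `^ (-1))%:E.
have mh : measurable_fun setT h.
  apply: measurable_fun_ifT.
  - exact: measurable_fun_eqr.
  - exact: measurable_cst.
  - by apply/measurable_EFinP; exact: measurable_powR.
apply: eq_measurable_fun (measurableT_comp mh mp) => x _ /=.
by rewrite /h inver; case: eqP => // _; rewrite powR_inv1.
Qed.

(** * Likelihood ratios *)

Section LikelihoodRatios.
Local Open Scope ereal_scope.
Context (R : realType) (d d' : measure_display) (T : measurableType d)
  (E : measurableType d') (p : nat) (Theta : set 'rV[R]_p)
  (M : changepoint_model T E Theta).
Implicit Types (theta : 'rV[R]_p) (w : T) (k n j : nat).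

Definition change_density k theta : forall j : nat, j.-tuple E -> E -> R :=
  fun j => if (j < k)%N then pre M (j:=j) else post M k theta (j:=j).

Definition lr_prod k n theta w : \bar R := \prod_(k <= j < n) lr M k theta j w.

Lemma cond_densities_change k theta :
  Theta theta -> cond_densities (dom M) (change_density k theta).
Proof.
move=> th j; rewrite /change_density; case: ifP => _; first exact: pre_density.
exact: post_density.
Qed.

Lemma pre_ge0 j w : (0 <= pre M (history (obs M) j w) (obs M j w))%R.
Proof. by have [h _ _] := pre_density M j; exact: h. Qed.

Lemma post_ge0 k theta j w : Theta theta ->
  (0 <= post M k theta (history (obs M) j w) (obs M j w))%R.
Proof. by move=> th; have [h _ _] := post_density M k th j; exact: h. Qed.

Lemma lr_ge0 k theta j w : Theta theta -> 0 <= lr M k theta j w.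
Proof. by move=> th; apply: ratio_ge0; [exact: post_ge0|exact: pre_ge0]. Qed.

Lemma lr_prod_ge0 k n theta w : Theta theta -> 0 <= lr_prod k n theta w.
Proof. by move=> th; apply: prode_ge0 => j _; exact: lr_ge0. Qed.

(** Exact also for degenerate ratios: the convention -oo + +oo = -oo on the
logarithmic side matches 0 * +oo = 0 for products. *)
Lemma expeR_llr k n theta w : Theta theta ->
  expeR (llr M k n theta w) = lr_prod k n theta w.
Proof.
move=> th; rewrite /llr /lr_prod.
apply: (big_rec2 (fun x y => expeR x = y)) => [|j x y _ <-]; first exact: expeR0.
by rewrite expeRD lneK// in_itv/= leey andbT lr_ge0.
Qed.

Lemma le_llr k n theta w (c : R) : Theta theta ->
  (c%:E <= llr M k n theta w) = ((expR c)%:E <= lr_prod k n theta w).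
Proof. by move=> th; rewrite -expeR_llr// -lee_expeR. Qed.

Lemma llr_lt k n theta w (c : R) : Theta theta ->
  (llr M k n theta w < c%:E) = (lr_prod k n theta w < (expR c)%:E).
Proof. by move=> th; rewrite !ltNge le_llr. Qed.

Lemma joint_pre_split k n w : (k <= n)%N ->
  joint_density (pre M) (history (obs M) n w) =
  ((\prod_(0 <= j < k) pre M (history (obs M) j w) (obs M j w)) *
   \prod_(k <= j < n) pre M (history (obs M) j w) (obs M j w))%R.
Proof.
move=> kn; rewrite joint_density_history -(big_mkord xpredT
  (fun j => pre M (history (obs M) j w) (obs M j w))).
by rewrite (@big_cat_nat _ _ _ k).
Qed.

Lemma joint_change_split k n theta w : (k <= n)%N ->
  joint_density (change_density k theta) (history (obs M) n w) =
  ((\prod_(0 <= j < k) pre M (history (obs M) j w) (obs M j w)) *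
   \prod_(k <= j < n) post M k theta (history (obs M) j w) (obs M j w))%R.
Proof.
move=> kn; rewrite joint_density_history -(big_mkord xpredT
  (fun j => change_density k theta (history (obs M) j w) (obs M j w))).
rewrite (@big_cat_nat _ _ _ k)//=; congr (_ * _)%R.
  rewrite [LHS]big_nat [RHS]big_nat; apply: eq_bigr => j /andP[_ jk].
  by rewrite /change_density jk.
rewrite [LHS]big_nat [RHS]big_nat; apply: eq_bigr => j /andP[kj _].
by rewrite /change_density ltnNge kj.
Qed.

Lemma lr_prod_joint_le k n theta w : Theta theta -> (k <= n)%N ->
  lr_prod k n theta w * (joint_density (pre M) (history (obs M) n w))%:E <=
  (joint_density (change_density k theta) (history (obs M) n w))%:E.
Proof.
move=> th kn; rewrite (joint_pre_split _ kn) (joint_change_split _ _ kn).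
rewrite !EFinM muleCA lee_pmul// ?lee_fin ?prodr_ge0//.
- by move=> j _; exact: pre_ge0.
- by rewrite mule_ge0 ?lr_prod_ge0 ?lee_fin ?prodr_ge0// => j _; exact: pre_ge0.
apply: (prod_ratio_mul_le
  (f := fun j => post M k theta (history (obs M) j w) (obs M j w))
  (p := fun j => pre M (history (obs M) j w) (obs M j w))) => j.
- exact: post_ge0.
- exact: pre_ge0.
Qed.

Lemma joint_le_of_lr_prod_le k n theta w (c : R) :
  Theta theta -> (k <= n)%N -> lr_prod k n theta w <= c%:E ->
  (joint_density (change_density k theta) (history (obs M) n w) <=
   c * joint_density (pre M) (history (obs M) n w))%R.
Proof.
move=> th kn lc; rewrite (joint_pre_split _ kn) (joint_change_split _ _ kn).
rewrite mulrCA ler_wpM2l// ?prodr_ge0//; first by move=> j _; exact: pre_ge0.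
apply: (prod_le_of_ratio_le
  (f := fun j => post M k theta (history (obs M) j w) (obs M j w))
  (p := fun j => pre M (history (obs M) j w) (obs M j w))) => // j.
- exact: post_ge0.
- exact: pre_ge0.
Qed.

Lemma Pchange_past k theta n (A : set T) : Theta theta -> (n <= k)%N ->
  natural_filtration (obs M) n A -> Pchange M k theta A = Pinf M A.
Proof.
move=> th nk FA.
have jd w : joint_density (change_density k theta) (history (obs M) n w) =
            joint_density (pre M) (history (obs M) n w).
  rewrite !joint_density_history; apply: eq_bigr => j _.
  by rewrite /change_density (leq_trans (ltn_ord j) nk).
have dpre := pre_density M; have dch := cond_densities_change k th.
have Ppre := Pinf_density M; have Pch := Pchange_density M k th.
apply/eqP; rewrite eq_le -(mul1e (Pchange M k theta A)) -(mul1e (Pinf M A)).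
apply/andP; split; rewrite [leRHS]mul1e.
- by apply: (change_of_measure dch dpre Pch Ppre _ FA) => // w _; rewrite mul1r jd.
- by apply: (change_of_measure dpre dch Ppre Pch _ FA) => // w _; rewrite mul1r jd.
Qed.

(** The change of measure from the post-change to the pre-change law: where the
likelihood ratio is at most c, the post-change density is at most c times the
pre-change one. *)
Lemma Pchange_le_of_lr_prod k n theta (c : R) (A : set T) :
  Theta theta -> (k <= n)%N -> (0 < c)%R -> natural_filtration (obs M) n A ->
  (forall w, A w -> lr_prod k n theta w <= c%:E) ->
  Pchange M k theta A <= c%:E * Pinf M A.
Proof.
move=> th kn c0 FA Ac; rewrite -lee_pdivrMl//.
have dpre := pre_density M; have dch := cond_densities_change k th.
have Ppre := Pinf_density M; have Pch := Pchange_density M k th.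
apply: (change_of_measure dch dpre Pch Ppre _ FA) => [|w Aw].
  by rewrite invr_ge0 ltW.
by rewrite ler_pdivrMl// joint_le_of_lr_prod_le// Ac.
Qed.

Lemma measurable_Theta : measurable (Theta : set (param_space Theta)).
Proof. by apply: sub_sigma_algebra; right. Qed.

(** Joint measurability in the parameter and the past; the product space is
restricted to Theta because the densities are measurable in the parameter only
there. *)
Lemma measurable_lr_joint k j n : (j < n)%N ->
  measurable_fun (Theta `*` setT : set (param_space Theta * past (obs M) n))
    (fun z => lr M k z.1 j z.2).
Proof.
move=> jn; have mh := measurable_history_past (obs M) (ltnW jn).
have mo := measurable_obs_past (obs M) jn.
have mho : measurable_fun [set: past (obs M) n]
    (fun w => (history (obs M) j w, obs M j w)).
  exact: measurable_fun_pair.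
apply: emeasurable_funM.
  apply/measurable_EFinP.
  pose h (z : param_space Theta * past (obs M) n) :
     param_space Theta * (j.-tuple E * E) :=
     (z.1, (history (obs M) j z.2, obs M j z.2)).
  have mh' : measurable_fun setT h.
    apply: measurable_fun_pair => //.
    exact: (measurableT_comp mho measurable_snd).
  have mpost := post_measurable M k (j:=j).
  apply: (@measurable_comp _ _ _ _ _ _ _ _ _ h _ _ mpost).
  - by apply: measurableX => //; exact: measurable_Theta.
  - by move=> _ [[t w] [/= tT _] <-].
  - exact: measurable_funS mh'.
apply: measurable_inve_ge0; first by move=> z; exact: pre_ge0.
apply: (@measurable_funS _ _ _ _ setT) => //.
have [_ mpre _] := pre_density M j.
have := measurableT_comp mpre (measurableT_comp mho measurable_snd).
by apply.
Qed.

Lemma measurable_lr_prod_joint k m n : (m <= n)%N ->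
  measurable_fun (Theta `*` setT : set (param_space Theta * past (obs M) n))
    (fun z => lr_prod k m z.1 z.2).
Proof.
move=> mn; apply: emeasurable_prod => j; rewrite mem_index_iota => /andP[_ jm].
by apply: measurable_lr_joint; exact: leq_trans mn.
Qed.

Lemma measurable_lr_prod k m n theta : Theta theta -> (m <= n)%N ->
  measurable_fun [set: past (obs M) n] (lr_prod k m theta).
Proof.
move=> th mn.
have h := measurable_lr_prod_joint k mn.
pose h' (w : past (obs M) n) : param_space Theta * past (obs M) n := (theta, w).
apply: (@measurable_comp _ _ _ _ _ _ _ _ _ h' _ _ h).
- by apply: measurableX => //; exact: measurable_Theta.
- by move=> _ [w _ <-].
- exact: measurable_fun_pair.
Qed.

End LikelihoodRatios.
Arguments measurable_lr_prod {R d d' T E p Theta} M k {m n theta}.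
Arguments measurable_lr_prod_joint {R d d' T E p Theta} M k {m n}.
Arguments cond_densities_change {R d d' T E p Theta} M k {theta}.
Arguments lr_prod_joint_le {R d d' T E p Theta} M {k n theta} w.

(** * Measurability of the weighted statistic and stopping times *)

Section WeightedShiryaevRoberts.
Local Open Scope ereal_scope.
Context (R : realType) (d d' : measure_display) (T : measurableType d)
  (E : measurableType d') (p : nat) (Theta : set 'rV[R]_p)
  (M : changepoint_model T E Theta) (W : probability (param_space Theta) R).
Implicit Types (theta : 'rV[R]_p) (w : T) (k n j : nat) (a : R).

(** On an event where the likelihood ratio is at least c, the change of measure
gives c Pinf <= P_{k,theta}; [ge0_integral_le_measure] integrates this over the
values of c. The integral is transported to the space [past] so that only
level sets known at time n occur. *)
Lemma integral_lr_prod_le k n theta (A : set T) : Theta theta -> (k <= n)%N ->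
  natural_filtration (obs M) n A ->
  \int[Pinf M]_(w in A) lr_prod M k n theta w <= Pchange M k theta A.
Proof.
move=> th kn FA.
pose phi : {mfun T >-> past (obs M) n} :=
  mfun_Sub (mem_set (@measurable_id_past _ _ _ _ _ (obs_measurable M) n)).
have mA : measurable (A : set (past (obs M) n)) by exact/measurable_past.
have mlr := measurable_lr_prod M k th (leqnn n).
have -> : \int[Pinf M]_(w in A) lr_prod M k n theta w =
    \int[pushforward (Pinf M) phi]_(w in A) lr_prod M k n theta w.
  rewrite ge0_integral_pushforward//.
  - exact: measurable_funS mlr.
  - by move=> w _; exact: lr_prod_ge0.
apply: (@ge0_integral_le_measure _ _ _ (pushforward (Pinf M) phi)
  (pushforward (Pchange M k theta) phi)) => //.
  by move=> w _; exact: lr_prod_ge0.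
move=> c B c0 /measurable_past FB BA cB; rewrite /pushforward/=.
apply: (change_of_measure (pre_density M) (cond_densities_change M k th)
  (Pinf_density M) (Pchange_density M k th) c0 FB) => w Bw.
rewrite -lee_fin; apply: le_trans (lr_prod_joint_le M w th kn).
rewrite EFinM lee_wpmul2r ?cB//.
by rewrite lee_fin (joint_density_ge0 _ (pre_density M)).
Qed.

Lemma measurable_wsr m n : (m <= n)%N ->
  measurable_fun [set: past (obs M) n] (wsr M W m).
Proof.
move=> mn.
pose f (z : param_space Theta * past (obs M) n) :=
  \sum_(0 <= k < m) lr_prod M k m z.1 z.2.
pose D : set (param_space Theta * past (obs M) n) := Theta `*` setT.
have mD : measurable D by apply: measurableX => //; exact: measurable_Theta.
have mf : measurable_fun setT (f \_ D).
  apply/(measurable_restrictT f mD).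
  apply: (@emeasurable_sum _ _ _ D nat (index_iota 0 m)
    (fun k z => lr_prod M k m z.1 z.2)) => k.
  exact: measurable_lr_prod_joint.
have f0 z : 0 <= (f \_ D) z.
  by apply: erestrict_ge0 => -[t w] [/= tT _]; apply: sume_ge0 => k _; exact: lr_prod_ge0.
have := measurable_fun_fubini_tonelli_G (m1 := W) _ mf f0.
apply: eq_measurable_fun => w _; rewrite /fubini_G /wsr [RHS]integral_mkcond.
apply: eq_integral => t _; rewrite !patchE.
have [tT|tT] := boolP (t \in (Theta : set (param_space Theta))).
  by rewrite mem_set//; split => //=; exact: set_mem.
by rewrite memNset// => -[/= /mem_set tT2 _]; rewrite tT2 in tT.
Qed.

Lemma wsr_ge0 n w : 0 <= wsr M W n w.
Proof.
by apply: integral_ge0 => t tT; apply: sume_ge0 => k _; exact: lr_prod_ge0.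
Qed.

Lemma le_lne_wsr a n w :
  (a%:E <= lne (wsr M W n w)) = ((expR a)%:E <= wsr M W n w).
Proof. by rewrite -lee_expeR/= lneK// in_itv/= leey wsr_ge0. Qed.

Lemma wsr_timeP a w : wsr_time M W a w = +oo \/
  exists n, [/\ wsr_time M W a w = n%:R%:E, (1 <= n)%N &
    (expR a)%:E <= wsr M W n w].
Proof.
pose P n := (1 <= n)%N && ((expR a)%:E <= wsr M W n w).
have [/cid [n0 Pn0]|nP] := pselect (exists n, P n); last first.
  left; rewrite /wsr_time (_ : [set n | _] = set0) ?image_set0 ?ereal_inf0//.
  apply/seteqP; split=> n //= -[n1]; rewrite le_lne_wsr => an; apply: nP.
  by exists n; rewrite /P n1.
right; case: (ex_minnP (ex_intro _ n0 Pn0)) => n /andP[n1 an] nmin.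
exists n; split => //; apply/eqP; rewrite eq_le; apply/andP; split.
  by apply: ereal_inf_lbound; exists n => //=; rewrite le_lne_wsr.
apply: le_ereal_inf_tmp => _ [j [/= j1 aj] <-]; rewrite le_lne_wsr in aj.
by rewrite lee_fin ler_nat nmin// /P j1.
Qed.

Lemma wsr_time_le a n w : (wsr_time M W a w <= n%:R%:E) <->
  exists2 j, (1 <= j <= n)%N & (expR a)%:E <= wsr M W j w.
Proof.
split.
  case: (wsr_timeP a w) => [->//|[j [-> j1 aj]]].
  by rewrite lee_fin ler_nat => jn; exists j; rewrite ?j1.
move=> [j /andP[j1 jn] aj]; apply: (@le_trans _ _ j%:R%:E).
  by apply: ereal_inf_lbound; exists j => //=; rewrite le_lne_wsr.
by rewrite lee_fin ler_nat.
Qed.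

Lemma wsr_time_filtration a n :
  natural_filtration (obs M) n [set w | wsr_time M W a w <= n%:R%:E].
Proof.
rewrite (_ : [set w | _] = \bigcup_(j in [set j | 1 <= j <= n]%N)
   [set w | (expR a)%:E <= wsr M W j w]); last first.
  apply/seteqP; split=> w /=; first by move=> /wsr_time_le[j ? ?]; exists j.
  by move=> [j ? ?]; apply/wsr_time_le; exists j.
apply/measurable_past; apply: bigcup_measurable => j /= /andP[_ jn].
rewrite -[X in measurable X]setTI.
exact: emeasurable_fun_c_infty (measurable_wsr jn) _.
Qed.

Lemma wsr_time_stopping a : stopping_time M (wsr_time M W a).
Proof.
split; last exact: wsr_time_filtration.
by move=> w; case: (wsr_timeP a w) => [->|[n [-> _ _]]]; [left|right; exists n].
Qed.

End WeightedShiryaevRoberts.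

Section StoppingTimes.
Local Open Scope ereal_scope.
Context (R : realType) (d d' : measure_display) (T : measurableType d)
  (E : measurableType d') (p : nat) (Theta : set 'rV[R]_p)
  (M : changepoint_model T E Theta) (tau : T -> \bar R)
  (tau_stop : stopping_time M tau).

Lemma natural_filtration_mono m n : (m <= n)%N ->
  natural_filtration (obs M) m `<=` natural_filtration (obs M) n.
Proof.
move=> mn A /natural_filtrationP[B mB <-]; apply/measurable_past.
rewrite -[X in measurable X]setTI.
exact: (measurable_history_past (obs M) mn).
Qed.

Lemma stopping_le n : natural_filtration (obs M) n [set w | tau w <= n%:R%:E].
Proof. by have [_] := tau_stop; exact. Qed.

Lemma stopping_gt n : natural_filtration (obs M) n [set w | n%:R%:E < tau w].
Proof.
apply/measurable_past; rewrite (_ : [set w | _] = ~` [set w | tau w <= n%:R%:E]).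
  by apply: measurableC; apply/measurable_past; exact: stopping_le.
by apply/seteqP; split=> w /=; rewrite ltNge => /negP.
Qed.

(** Stopping times take only integer values or +oo. *)
Lemma ltS_stopping n w : (tau w < n.+1%:R%:E) = (tau w <= n%:R%:E).
Proof.
have [+ _] := tau_stop => /(_ w)[->|[k ->]]; first by rewrite ltNge leey leye_eq.
by rewrite lte_fin lee_fin ltr_nat ler_nat.
Qed.

Lemma leS_stopping n w : (n.+1%:R%:E <= tau w) = (n%:R%:E < tau w).
Proof. by rewrite leNgt ltS_stopping -ltNge. Qed.

Lemma stopping_eq n : natural_filtration (obs M) n [set w | tau w = n%:R%:E].
Proof.
case: n => [|n].
  rewrite (_ : [set w | _] = [set w | tau w <= 0%:R%:E]); first exact: stopping_le.
  apply/seteqP; split=> w /=; first by move=> ->.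
  have [+ _] := tau_stop => /(_ w)[->//|[k ->]].
  by rewrite lee_fin ler_nat leqn0 => /eqP ->.
rewrite (_ : [set w | _] = [set w | tau w <= n.+1%:R%:E] `&` [set w | n%:R%:E < tau w]).
  apply/measurable_past; apply: measurableI; apply/measurable_past.
    exact: stopping_le.
  by apply: (natural_filtration_mono (leqnSn n)); exact: stopping_gt.
apply/seteqP; split=> w /=.
  by move=> ->; rewrite lexx lte_fin ltr_nat.
by rewrite -leS_stopping => -[? ?]; apply/eqP; rewrite eq_le; exact/andP.
Qed.

Lemma measurable_stopping : measurable_fun setT tau.
Proof.
apply: (measurability _ (ErealGenOInfty.measurableE R)) => _ [_ [x ->] <-].
rewrite setTI (_ : _ @^-1` _ = ~` (\bigcup_(n in [set n : nat | n%:R%:E <= x%:E])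
    [set w | tau w = n%:R%:E])).
  apply: measurableC; apply: bigcup_measurable => n _.
  exact (natural_filtration_measurable (obs_measurable M) (@stopping_eq n)).
apply/seteqP; split=> w /=; rewrite in_itv/= andbT.
  by move=> xt [n /= nx tn]; move: xt; rewrite tn ltNge nx.
move=> H; rewrite ltNge; apply/negP => tx; apply: H.
have [+ _] := tau_stop => /(_ w)[ty|[n tn]]; first by move: tx; rewrite ty.
by exists n; rewrite //= -tn.
Qed.
End StoppingTimes.

(** * The false alarm probability *)

Section FalseAlarm.
Local Open Scope ereal_scope.
Context (R : realType) (d d' : measure_display) (T : measurableType d)
  (E : measurableType d') (p : nat) (Theta : set 'rV[R]_p)
  (M : changepoint_model T E Theta) (W : probability (param_space Theta) R)
  (W_Theta : W (Theta : set (param_space Theta)) = 1).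
Implicit Types (theta : 'rV[R]_p) (w : T) (k n j : nat) (a : R).

(** The Pinf-mean on A of the Shiryaev-Roberts statistic at a fixed parameter. *)
Let sr_mean n (A : set T) theta : \bar R :=
  \sum_(0 <= k < n) \int[Pinf M]_(w in A) lr_prod M k n theta w.

Lemma measurable_lr_prodT k n theta : Theta theta ->
  measurable_fun [set: T] (lr_prod M k n theta).
Proof.
move=> th.
apply: (@measurableT_comp _ _ _ _ (past (obs M) n) _ (lr_prod M k n theta)
  setT (id : T -> past (obs M) n)).
  exact: measurable_lr_prod.
exact (measurable_id_past (obs_measurable M) (n:=n)).
Qed.

Lemma measurable_sr_mean_wsr n (A : set T) : natural_filtration (obs M) n A ->
  measurable_fun (Theta : set (param_space Theta)) (sr_mean n A) /\
  \int[Pinf M]_(w in A) wsr M W n w =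
    \int[W]_(theta in (Theta : set (param_space Theta))) sr_mean n A theta.
Proof.
move=> FA; have mA := natural_filtration_measurable (obs_measurable M) FA.
pose g (z : param_space Theta * T) : \bar R :=
  \sum_(0 <= k < n) lr_prod M k n z.1 z.2.
pose D : set (param_space Theta * T) := Theta `*` A.
have mD : measurable D by apply: measurableX => //; exact (@measurable_Theta R p Theta).
have mg : measurable_fun D g.
  apply: (@emeasurable_sum _ _ _ D nat (index_iota 0 n)
    (fun k z => lr_prod M k n z.1 z.2)) => k.
  pose h (z : param_space Theta * T) : param_space Theta * past (obs M) n :=
    (z.1, z.2).
  apply: (@measurable_comp _ _ _ _ _ _ _ _ _ h _ _
    (measurable_lr_prod_joint M k (leqnn n))).
  - by apply: measurableX => //; exact (@measurable_Theta R p Theta).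
  - by move=> _ [[t w] [/= tT _] <-].
  - apply: (@measurable_funS _ _ _ _ setT) => //; apply: measurable_fun_pair => //.
    exact (measurableT_comp (measurable_id_past (obs_measurable M) (n:=n)) measurable_snd).
have mf : measurable_fun setT (g \_ D) by exact/(measurable_restrictT g mD).
have f0 z : 0 <= (g \_ D) z.
  by apply: erestrict_ge0 => -[t w] [/= tT _]; apply: sume_ge0 => k _; exact: lr_prod_ge0.
have FE t : \int[Pinf M]_w (g \_ D) (t, w) =
    (sr_mean n A \_ (Theta : set (param_space Theta))) t.
  rewrite patchE; case: ifPn => [/set_mem tT|tT].
    rewrite /sr_mean -ge0_integral_sum//; first last.
    - by move=> k w _; exact: lr_prod_ge0.
    - by move=> k; apply: measurable_funTS; exact: measurable_lr_prodT.
    rewrite [RHS]integral_mkcond; apply: eq_integral => w _; rewrite !patchE.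
    have [wA|wA] := boolP (w \in A); first by rewrite mem_set//; split => //=; exact: set_mem.
    by rewrite memNset// => -[/= _ /mem_set wA2]; rewrite wA2 in wA.
  rewrite integral0_eq// => w _; rewrite patchE memNset// => -[/= /mem_set tT2].
  by rewrite tT2 in tT.
have GE w : \int[W]_t (g \_ D) (t, w) = (wsr M W n \_ A) w.
  rewrite patchE; case: ifPn => [/set_mem wA|wA].
    rewrite /wsr [RHS]integral_mkcond; apply: eq_integral => t _; rewrite !patchE.
    have [tT|tT] := boolP (t \in (Theta : set (param_space Theta))).
      by rewrite mem_set//; split => //=; exact: set_mem.
    by rewrite memNset// => -[/= /mem_set tT2 _]; rewrite tT2 in tT.
  rewrite integral0_eq// => t _; rewrite patchE memNset// => -[/= _ /mem_set wA2].
  by rewrite wA2 in wA.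
split.
  apply/measurable_restrictT; first exact (@measurable_Theta R p Theta).
  apply: eq_measurable_fun (measurable_fun_fubini_tonelli_F (m2 := Pinf M) _ mf f0).
  by move=> t _; exact: FE.
rewrite [LHS]integral_mkcond [RHS]integral_mkcond.
under eq_integral do rewrite -GE.
under [RHS]eq_integral do rewrite -FE.
by rewrite (fubini_tonelli (m1 := W) (m2 := Pinf M) _ mf f0).
Qed.

Lemma sr_mean_ge0 n A theta : Theta theta -> 0 <= sr_mean n A theta.
Proof.
move=> th; apply: sume_ge0 => k _; apply: integral_ge0 => w _.
exact: lr_prod_ge0.
Qed.

(** A bound in the manner of Doob's maximal inequality, valid even where a
post-change law is not absolutely continuous: on the event that the time equals
j the statistic is at least e^a, and its Pinf-mean on that event is the
W-average over theta of a sum over k < j of terms bounded by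
P_{k,theta}(T_a = j). Summing over j first, each k contributes at most 1. *)
Lemma wsr_false_alarm a n :
  (expR a)%:E * Pinf M [set w | wsr_time M W a w <= n%:R%:E] <= n%:R%:E.
Proof.
pose A j := [set w | wsr_time M W a w = j%:R%:E].
have st := wsr_time_stopping M W a.
have FA j : natural_filtration (obs M) j (A j) by exact: stopping_eq.
have mA j : measurable (A j).
  exact (natural_filtration_measurable (obs_measurable M) (FA j)).
have tA : trivIset setT A.
  move=> i j _ _ [w []]; rewrite /A/= => -> -[] /eqP.
  by rewrite eqr_nat => /eqP.
have -> : [set w | wsr_time M W a w <= n%:R%:E] = \big[setU/set0]_(j < n.+1) A j.
  rewrite -bigcup_mkord; apply/seteqP; split=> w /=.
    have [/(_ w)[->//|[j tj]] _] := st; rewrite tj lee_fin ler_nat => jn.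
    by exists j; rewrite /= ?ltnS.
  by move=> [j /= jn ->]; rewrite lee_fin ler_nat -ltnS.
rewrite measure_bigsetU// ge0_sume_distrr; last by move=> *; exact: measure_ge0.
apply: (@le_trans _ _ (\sum_(j < n.+1)
   \int[W]_(theta in (Theta : set (param_space Theta))) sr_mean j (A j) theta)).
  apply: lee_sum => j _; rewrite -(measurable_sr_mean_wsr (FA j)).2.
  rewrite -[X in _ * X]mul1e -integral_cst//.
  apply: ge0_scale_integral_le; [exact: expR_ge0|by []|move=> w tj].
  rewrite mule1; have := wsr_timeP M W a w; rewrite tj => -[//|[i [[]]]].
  by move=> /eqP; rewrite eqr_nat => /eqP ->.
rewrite -(ge0_integral_sum _ (@measurable_Theta R p Theta)
  (fun j : 'I_n.+1 => (measurable_sr_mean_wsr (FA j)).1)); last first.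
  by move=> j theta th; exact: sr_mean_ge0.
apply: (@le_trans _ _ (\int[W]_(theta in (Theta : set (param_space Theta)))
    (cst n%:R%:E) theta)); last first.
  rewrite integral_cst; last exact (@measurable_Theta R p Theta).
  by rewrite [X in _ * X]W_Theta mule1.
apply: ge0_le_integral => //.
- exact (@measurable_Theta R p Theta).
- by move=> theta th; apply: sume_ge0 => j _; exact: sr_mean_ge0.
- by apply: emeasurable_sum => j; exact: (measurable_sr_mean_wsr (FA j)).1.
move=> theta th /=.
pose J k j := \int[Pinf M]_(w in A j) lr_prod M k j theta w.
rewrite -(big_mkord xpredT (fun j => sr_mean j (A j) theta)).
rewrite (_ : \sum_(0 <= j < n.+1) sr_mean j (A j) theta =
  \sum_(0 <= j < n.+1) \sum_(0 <= k < n | (k < j)%N) J k j); last first.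
  rewrite [LHS]big_nat [RHS]big_nat; apply: eq_bigr => j /andP[_ jn].
  by rewrite /sr_mean (big_nat_widen _ _ n) -1?ltnS.
rewrite (exchange_big_dep_nat xpredT)//=.
have -> : n%:R%:E = \sum_(0 <= k < n) (1 : \bar R).
  by rewrite sumEFin big_const_nat subn0 iter_addr_0.
apply: lee_sum => k _.
apply: (@le_trans _ _ (\sum_(0 <= j < n.+1) Pchange M k theta (A j))).
  rewrite [leRHS](bigID (fun j => (k < j)%N))/=.
  apply: (@le_trans _ _ (\sum_(0 <= j < n.+1 | (k < j)%N) Pchange M k theta (A j))).
    apply: lee_sum => j kj; apply: integral_lr_prod_le => //; exact: ltnW.
  by rewrite leeDl// sume_ge0.
rewrite big_mkord -measure_bigsetU//.
apply: probability_le1; apply: bigsetU_measurable => //.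
Qed.

End FalseAlarm.

(** * Membership in the class *)

Lemma expr_onem_bernoulli (R : realType) (x : R) n : 0 <= x <= 1 ->
  (1 - x) ^+ n * (1 + n%:R * x) <= 1.
Proof.
move=> /andP[x0 x1]; elim: n => [|n IHn]; first by rewrite expr0 mul0r addr0 mul1r.
apply: le_trans IHn; rewrite exprSr -mulrA ler_wpM2l//.
  by rewrite exprn_ge0// subr_ge0.
rewrite -natr1.
have n0 : 0 <= n%:R :> R by [].
nra.
Qed.

Section ClassMembership.
Context (R : realType) (d d' : measure_display) (T : measurableType d)
  (E : measurableType d') (p : nat) (Theta : set 'rV[R]_p)
  (M : changepoint_model T E Theta) (W : probability (param_space Theta) R)
  (W_Theta : W (Theta : set (param_space Theta)) = 1%E).

Lemma wsr_false_alarm_le (rho alpha : R) n : 0 < rho -> 0 < alpha < 1 ->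
  (Pinf M [set w |
      wsr_time M W (ln ((1 - alpha) / (rho * alpha))) w <= n%:R%:E] <=
    (n%:R * (rho * alpha / (1 - alpha)))%:E)%E.
Proof.
move=> rho0 /andP[al0 al1]; set a := ln _.
have q0 : 0 < (1 - alpha) / (rho * alpha) by rewrite divr_gt0 ?mulr_gt0 ?subr_gt0.
have := wsr_false_alarm M W_Theta a n.
rewrite lnK ?posrE// -lee_pdivlMl// => h; apply: le_trans h _.
by rewrite -EFinM lee_fin invf_div mulrC.
Qed.

(** With K = l + m and b = beta / (1 + beta), Bernoulli's inequality gives
K rho (1 - rho)^K <= 1 - (1 - rho)^K, hence Pinf(T <= n) <= b for all n <= K.
Then Pinf(T >= k) >= 1 - b, and b / (1 - b) = beta. *)
Lemma wsr_class_H (beta rho : R) (l m : nat) :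
  0 < beta < 1 -> 0 < rho < 1 ->
  let alpha := beta * (1 - rho) ^+ (l + m) / (1 + beta) in
  let a := ln ((1 - alpha) / (rho * alpha)) in
  class_H M beta l m (wsr_time M W a).
Proof.
move=> /andP[b0 b1] /andP[r0 r1] alpha a.
set tau := wsr_time M W a.
have st : stopping_time M tau by exact: wsr_time_stopping.
pose x := (1 - rho) ^+ (l + m).
have x0 : 0 < x by rewrite exprn_gt0// subr_gt0.
pose b := beta / (1 + beta).
have b10 : 0 < 1 + beta by rewrite addr_gt0.
have bx : 0 < b < 1 by rewrite divr_gt0//= ltr_pdivrMr// mul1r ltrDr.
have alE : alpha = b * x by rewrite /alpha /b mulrAC.
have bern : x * (1 + (l + m)%:R * rho) <= 1.
  by apply: expr_onem_bernoulli; rewrite !ltW.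
have lm0 : 0 <= (l + m)%:R * rho by rewrite mulr_ge0// ltW.
have al : 0 < alpha < 1.
  have /andP[? ?] := bx; rewrite alE mulr_gt0//=; nra.
have Pb n : (n <= l + m)%N -> (Pinf M [set w | tau w <= n%:R%:E] <= b%:E)%E.
  move=> nlm; apply: le_trans (wsr_false_alarm_le _ r0 al) _.
  have /andP[al0 al1] := al; have /andP[bb0 bb1] := bx.
  have nlm' : n%:R * rho <= (l + m)%:R * rho by rewrite ler_wpM2r ?(ltW r0)// ler_nat.
  rewrite lee_fin mulrA ler_pdivrMr ?subr_gt0// alE.
  rewrite (_ : n%:R * (rho * (b * x)) = b * (x * (n%:R * rho))); last by ring.
  rewrite ler_wpM2l ?(ltW bb0)//.
  have : x * (n%:R * rho) <= x * ((l + m)%:R * rho) by rewrite ler_wpM2l// ltW.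
  nra.
have mle n : measurable [set w | (tau w <= n%:R%:E)%E].
  exact (natural_filtration_measurable (obs_measurable M) (stopping_le st (n:=n))).
have mgt n : measurable [set w | (n%:R%:E < tau w)%E].
  exact (natural_filtration_measurable (obs_measurable M) (stopping_gt st (n:=n))).
have mge k : (1 <= k <= l)%N -> measurable [set w | (k%:R%:E <= tau w)%E].
  case: k => // k _; rewrite (_ : [set w | _] = [set w | (k%:R%:E < tau w)%E])//.
  by apply/seteqP; split=> w /=; rewrite (leS_stopping st).
have Pge k : (1 <= k <= l)%N -> ((1 - b)%:E <= Pinf M [set w | k%:R%:E <= tau w])%E.
  case: k => // k /andP[_ kl].
  rewrite (_ : [set w | _] = ~` [set w | (tau w <= k%:R%:E)%E]); last first.
    by apply/seteqP; split=> w /=; rewrite (leS_stopping st) ltNge => /negP.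
  rewrite probability_setC// EFinB leeB//.
  by apply: Pb; rewrite (leq_trans (leqnSn _))// (leq_trans kl)// leq_addr.
have ob : 0 < 1 - b by have /andP[? ?] := bx; rewrite subr_gt0.
split=> // [k kl|]; first by apply: lt_le_trans (Pge _ kl); rewrite lte_fin.
apply: ge_ereal_sup => _ [k /= kl <-].
have PF : Pinf M [set w | (k%:R%:E <= tau w)%E] \is a fin_num.
  by apply: fin_num_measure; exact: mge.
have Pk := Pge _ kl; rewrite -(fineK PF) in Pk *.
set P := fine _ in Pk *; rewrite lee_fin in Pk.
have P0 : 0 < P by exact: lt_le_trans Pk.
rewrite inver gt_eqF// lee_pdivrMr//.
apply: (@le_trans _ _ b%:E); last first.
  rewrite -EFinM lee_fin.
  have bE : b = beta * (1 - b) by rewrite /b; field; rewrite gt_eqF.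
  by rewrite {1}bE ler_wpM2l// ltW.
move: (kl); case: k kl {PF Pk P P0} => // k kl1 /andP[_ kl].
apply: le_trans (Pb (k + m)%N _); last by rewrite leq_add2r ltnW.
apply: le_measure; rewrite ?inE//.
  apply: measurableI.
    rewrite addSn (_ : [set w | _] = [set w | (tau w <= (k + m)%:R%:E)%E])//.
    by apply/seteqP; split=> w /=; rewrite (ltS_stopping st).
  exact: mge.
by move=> w [/= + _]; rewrite addSn (ltS_stopping st).
Qed.

End ClassMembership.

(** * Lower bounds for procedures of the class *)

Lemma le_bigmaxe_seq (R : realType) (I : eqType) (s : seq I) (F : I -> \bar R) (c : R) :
  (c%:E <= \big[maxe/-oo]_(i <- s) F i)%E = has (fun i => c%:E <= F i)%E s.
Proof.
elim: s => [|i s IHs]; first by rewrite big_nil.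
by rewrite big_cons le_max IHs.
Qed.

Section LowerBound.
Local Open Scope ereal_scope.
Context (R : realType) (d d' : measure_display) (T : measurableType d)
  (E : measurableType d') (p : nat) (Theta : set 'rV[R]_p)
  (M : changepoint_model T E Theta).
Implicit Types (theta : 'rV[R]_p) (tau : T -> \bar R).

(** The history of length 0 is constant. *)
Lemma natural_filtration0 (A : set T) : natural_filtration (obs M) 0 A ->
  A !=set0 -> A = setT.
Proof.
move=> /natural_filtrationP[B _ <-] [w0 /= Bw0]; apply/seteqP; split=> w // _.
by rewrite /= (tuple0 (history (obs M) 0 w)) -(tuple0 (history (obs M) 0 w0)).
Qed.

(** The event tau >= 1 belongs to the trivial sigma-algebra at time 0 and has
positive probability, so it is everything: the constraint at k = 1 is an
unconditional one. *)
Lemma class_H_early beta l m tau : (1 <= l)%N -> class_H M beta l m tau ->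
  Pinf M [set w | tau w <= m%:R%:E] <= beta%:E.
Proof.
move=> l1 [st pos supH].
have k1 : (1 <= 1 <= l)%N by rewrite l1.
have T1 : [set w | 1%:R%:E <= tau w] = setT.
  have -> : [set w | 1%:R%:E <= tau w] = [set w | 0%:R%:E < tau w].
    by apply/seteqP; split=> w /=; rewrite (leS_stopping st).
  apply: natural_filtration0; first exact (stopping_gt st (n:=0%N)).
  apply/set0P/eqP => e; have := pos _ k1.
  rewrite (_ : [set w | 1%:R%:E <= tau w] = set0) ?measure0 ?ltxx//.
  by rewrite -e; apply/seteqP; split=> w /=; rewrite (leS_stopping st).
apply: le_trans supH; apply: ereal_sup_ubound; exists 1%N => //.
rewrite T1 setIT probability_setT inver oner_eq0 invr1 mule1; congr (Pinf M _).
by apply/seteqP; split=> w /=; rewrite add1n (ltS_stopping st).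
Qed.

Lemma llr_ge_filtration k n theta (c : R) : Theta theta ->
  natural_filtration (obs M) n [set w | c%:E <= llr M k n theta w].
Proof.
move=> th; apply/measurable_past; rewrite -[X in measurable X]setTI.
under eq_set do rewrite le_llr//.
exact: (emeasurable_fun_c_infty measurableT (measurable_lr_prod M k th (leqnn n))).
Qed.

Arguments llr_ge_filtration k n {theta} c.

(** The event of stopping in the window (nu, nu + N] is known at time nu + N, so
a single change of measure at that time suffices: it is split according to
whether the log-likelihood ratio exceeds C there. *)
Lemma Pchange_detect_le beta l m nu N theta tau (C : R) :
  (1 <= l)%N -> class_H M beta l m tau -> Theta theta -> (nu + N <= m)%N ->
  Pchange M nu theta [set w | nu%:R%:E < tau w /\ tau w <= (nu + N)%:R%:E] <=
  Pchange M nu theta [set w | C%:E <= llr M nu (nu + N) theta w] +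
    (expR C * beta)%:E.
Proof.
move=> l1 Hb th Nm; have [st _ _] := Hb.
have Fgt := natural_filtration_mono (leq_addr N nu) (stopping_gt st (n:=nu)).
have Fle := stopping_le st (n:=(nu + N)%N).
have FC := llr_ge_filtration nu (nu + N) C th.
have mm A : natural_filtration (obs M) (nu + N) A -> measurable A.
  by move=> h; exact (natural_filtration_measurable (obs_measurable M) h).
pose A := [set w | nu%:R%:E < tau w] `&` [set w | tau w <= (nu + N)%:R%:E].
pose B := [set w | C%:E <= llr M nu (nu + N) theta w].
have FA : natural_filtration (obs M) (nu + N) A.
  by apply/measurable_past/measurableI; apply/measurable_past.
have FAB : natural_filtration (obs M) (nu + N) (A `&` ~` B).
  by apply/measurable_past/measurableI; [|apply: measurableC]; apply/measurable_past.
rewrite -/A -/B.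
apply: (@le_trans _ _ (Pchange M nu theta (B `|` (A `&` ~` B)))).
  apply: le_measure; rewrite ?inE; [exact: mm|apply: measurableU; exact: mm|].
  by move=> w Aw; have [Bw|nBw] := pselect (B w); [left|right].
apply: le_trans (measureU2 _ _ _) _; [exact: mm|exact: mm|].
rewrite leeD2l//; apply: (@le_trans _ _ ((expR C)%:E * Pinf M (A `&` ~` B))).
  apply: (Pchange_le_of_lr_prod th (leq_addr N nu) (expR_gt0 _) FAB).
  by move=> w [_ /= /negP]; rewrite -ltNge llr_lt// => /ltW.
rewrite EFinM lee_pmul2l ?lte_fin ?expR_gt0//.
apply: le_trans (class_H_early l1 Hb); apply: le_measure; rewrite ?inE.
- exact: mm.
- exact (natural_filtration_measurable (obs_measurable M) (stopping_le st (n:=m))).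
- by move=> w [[_ /= tN] _]; apply: le_trans tN _; rewrite lee_fin ler_nat.
Qed.

(** The delay exceeds N on the event tau > nu + N, whose probability is at least
1 - x - y since the laws before and after the change agree up to time nu; the
normalisation by P(tau > nu) <= 1 only increases the risk. *)
Lemma risk_ge q nu N theta tau (x y : R) : (0 <= q)%R -> Theta theta ->
  stopping_time M tau ->
  Pinf M [set w | tau w <= nu%:R%:E] <= x%:E ->
  Pchange M nu theta [set w | nu%:R%:E < tau w /\ tau w <= (nu + N)%:R%:E]
    <= y%:E ->
  (x < 1)%R ->
  ((N%:R `^ q) * (1 - x - y))%:E <= risk M q nu theta tau.
Proof.
move=> q0 th st Px Py x1.
have mgt n : measurable [set w | n%:R%:E < tau w].
  exact (natural_filtration_measurable (obs_measurable M) (stopping_gt st (n:=n))).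
have mle n : measurable [set w | tau w <= n%:R%:E].
  exact (natural_filtration_measurable (obs_measurable M) (stopping_le st (n:=n))).
set P := Pchange M nu theta.
have PF A : measurable A -> P A \is a fin_num by move=> mA; exact: fin_num_measure.
pose G := [set w | nu%:R%:E < tau w].
pose G' := [set w | (nu + N)%:R%:E < tau w].
have PG : (1 - x)%:E <= P G.
  have -> : G = ~` [set w | tau w <= nu%:R%:E].
    by apply/seteqP; split=> w /=; rewrite /G/= ltNge => /negP.
  rewrite probability_setC// EFinB leeB//.
  by rewrite /P (Pchange_past th (leqnn nu))//; exact: stopping_le.
have PG' : (1 - x - y)%:E <= P G'.
  have GG' : P G <= P G' + y%:E.
    apply: (@le_trans _ _ (P (G' `|`
        [set w | nu%:R%:E < tau w /\ tau w <= (nu + N)%:R%:E]))).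
      apply: le_measure; rewrite ?inE; first exact: mgt.
        apply: measurableU; [exact: mgt|apply: measurableI; [exact: mgt|exact: mle]].
      move=> w Gw; have [G'w|] := boolP ((nu + N)%:R%:E < tau w); first by left.
      by rewrite -leNgt => ?; right.
    apply: le_trans (measureU2 _ _ _) _; first exact: mgt.
      by apply: measurableI; [exact: mgt|exact: mle].
    by rewrite leeD2l.
  by rewrite EFinB leeBlDr//; apply: le_trans PG GG'.
have NG' : (N%:R `^ q)%:E * P G' <= \int[P]_(w in G) (tau w - nu%:R%:E) `^ q.
  have <- : \int[P]_(w in G) (\1_G' w)%:E = P G'.
    rewrite integral_indic//; [|exact: mgt|exact: mgt]; congr (P _); apply/setIidl => w /=.
    by apply: le_lt_trans; rewrite lee_fin ler_nat leq_addr.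
  apply: ge0_scale_integral_le => [|w _|w Gw]; first exact: powR_ge0.
    by rewrite lee_fin.
  rewrite indicE; case: (boolP (w \in G')) => [/set_mem G'w|_]; last first.
    by rewrite mule0 poweR_ge0.
  rewrite mule1 -poweR_EFin gt0_ler_poweR//.
  - by rewrite in_itv/= leey andbT lee_fin.
  - have h : 0 <= tau w - nu%:R%:E by rewrite sube_ge0// ltW.
    by rewrite in_itv/= leey andbT; exact: h.
  rewrite leeBrDr// -EFinD -natrD addnC; exact: ltW.
rewrite /risk -/P -/G; have mG : measurable G by exact: mgt.
have := PF _ mG; case: (P G) PG (probability_le1 P mG) => // g PG g1 _.
rewrite !lee_fin in PG g1.
have g0 : (0 < g)%R by apply: lt_le_trans PG; rewrite subr_gt0.
rewrite inver gt_eqF// lee_pdivlMr//.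
apply: le_trans NG'; apply: (@le_trans _ _ ((N%:R `^ q)%:E * P G' * g%:E)).
  by rewrite lee_wpmul2r ?lee_fin ?(ltW g0)// EFinM lee_wpmul2l// lee_fin powR_ge0.
rewrite -[leRHS]mule1 lee_wpmul2l ?lee_fin//.
by rewrite mule_ge0// ?lee_fin ?powR_ge0// measure_ge0.
Qed.

(** The n = N term of the maximum is the one that the lower bound uses. *)
Lemma condition1_llr I k (eps : R) theta : (0 < eps)%R -> Theta theta ->
  condition1 M I ->
  Pchange M k theta [set w |
    ((1 + eps) * I theta * N%:R)%:E <= llr M k (k + N) theta w] @[N --> \oo] --> 0.
Proof.
move=> eps0 th /(_ k eps theta eps0 th) cond.
apply: squeeze_cvge cond; last exact: cvg_cst.
near=> N.
have N0 : (0 < N)%N by near: N; exact: nbhs_infty_gt.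
rewrite measure_ge0/=.
have mm n (c : R) : measurable [set w | c%:E <= llr M k n theta w].
  exact (natural_filtration_measurable (obs_measurable M) (llr_ge_filtration k n c th)).
set c := ((1 + eps) * I theta)%R.
have -> : [set w | c%:E <= N%:R^-1%:E *
      \big[maxe/-oo]_(1 <= n < N.+1) llr M k (k + n) theta w] =
    \bigcup_(n in [set n | (1 <= n < N.+1)%N])
      [set w | (c * N%:R)%:E <= llr M k (k + n) theta w].
  apply/seteqP; split=> w /=; rewrite lee_pdivlMl ?ltr0n// -EFinM mulrC le_bigmaxe_seq.
    by move=> /hasP[n]; rewrite mem_index_iota => nN cn; exists n.
  by move=> [n nN cn]; apply/hasP; exists n => //; rewrite mem_index_iota.
apply: le_measure; rewrite ?inE; first exact: mm.
  by apply: bigcup_measurable => n _; exact: mm.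
by move=> w cw; exists N => //=; rewrite N0 ltnSn.
Unshelve. all: by end_near. Qed.

End LowerBound.

(** * Upper bounds for the weighted procedure *)

Lemma continuous_enorm_dist (R : realType) p (theta : 'rV[R]_p) :
  continuous (fun u : 'rV[R]_p => enorm (u - theta)).
Proof.
have cs (s : seq 'I_p) : continuous
    (fun u : 'rV[R]_p => \sum_(i <- s) (u ord0 i - theta ord0 i) ^+ 2).
  elim: s => [|i s IHs].
    by under eq_fun do rewrite big_nil; exact: cst_continuous.
  under eq_fun do rewrite big_cons; move=> u.
  have ci : {for u, continuous (fun v : 'rV[R]_p => v ord0 i - theta ord0 i)}.
    apply: (@continuousB _ _ _ (fun v : 'rV[R]_p => v ord0 i) (cst (theta ord0 i))).
      exact: coord_continuous.
    exact: cst_continuous.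
  apply: (@continuousD _ _ _ (fun v : 'rV[R]_p => (v ord0 i - theta ord0 i) ^+ 2)
    (fun v : 'rV[R]_p => \sum_(j <- s) (v ord0 j - theta ord0 j) ^+ 2)).
    by apply: (continuousM ci ci).
  exact: IHs.
move=> u; rewrite /enorm.
under eq_fun do under eq_bigr do rewrite !mxE.
apply: (@continuous_comp _ _ _
  (fun u : 'rV[R]_p => \sum_(i < p) (u ord0 i - theta ord0 i) ^+ 2) Num.sqrt).
  exact: cs.
exact: sqrt_continuous.
Qed.

Lemma measurable_param_ball (R : realType) p (Theta : set 'rV[R]_p) theta (delta : R) :
  measurable [set u : param_space Theta |
    Theta u /\ enorm ((u : 'rV[R]_p) - theta) < delta].
Proof.
apply: measurableI; first exact: measurable_Theta.
apply: sub_sigma_algebra; left.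
apply: (@open_comp _ _ (fun u : 'rV[R]_p => enorm (u - theta)) [set x | x < delta]).
  by move=> u _; exact: continuous_enorm_dist.
exact: open_lt.
Qed.

(** Convexity of x |-> x^q between 1 and 2, at the point 1 + 1/n, where the
chord is 1 + (2^q - 1) / n. *)
Lemma powR_succ_sub_le (R : realType) (q : R) n : 1 <= q -> (1 <= n)%N ->
  n.+1%:R `^ q - n%:R `^ q <= (2 `^ q - 1) * n%:R `^ (q - 1).
Proof.
move=> q1 n1; have n0 : 0 < n%:R :> R by rewrite ltr0n.
have x01 : 0 <= (n%:R^-1 : R) <= 1.
  by rewrite invr_ge0 ltW//= invf_le1// ler1n.
have := convex_powR q1 (Itv01 (andP x01).1 (andP x01).2) (x := 2) (y := 1).
rewrite !inE/= !in_itv/= !andbT ler0n ler01 => /(_ isT isT).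
rewrite convRE [X in X `^ _ <= _]convRE/= powR1.
rewrite /unstable.onem !mulr1 => h.
have -> : n.+1%:R = n%:R * (n%:R^-1 * 2 + (1 - n%:R^-1)) :> R.
  by rewrite -natr1; field; rewrite gt_eqF.
rewrite powRM ?(ltW n0)//; last by have /andP[? ?] := x01; nra.
have -> : n%:R `^ (q - 1) = n%:R `^ q * n%:R^-1.
  rewrite -(mulr_powRB1 (ltW n0) (lt_le_trans ltr01 q1)) mulrAC mulfV ?mul1r//.
  by rewrite gt_eqF.
have : n%:R `^ q * (n%:R^-1 * 2 + (1 - n%:R^-1)) `^ q <=
   n%:R `^ q * (n%:R^-1 * 2 `^ q + (1 - n%:R^-1)).
  by rewrite ler_wpM2l ?powR_ge0.
move=> le; rewrite lerBlDr; apply: le_trans le _.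
by rewrite le_eqVlt; apply/orP; left; apply/eqP; ring.
Qed.

Lemma powR2_sub1_ge0 (R : realType) (q : R) : 0 <= q -> 0 <= 2 `^ q - 1.
Proof.
move=> q0; have := ge0_ler_powR q0 (x := 1) (y := 2).
by rewrite !nnegrE ler01 ler0n ler1n powR1 subr_ge0; apply.
Qed.

Section UpperBound.
Local Open Scope ereal_scope.
Context (R : realType) (d d' : measure_display) (T : measurableType d)
  (E : measurableType d') (p : nat) (Theta : set 'rV[R]_p)
  (M : changepoint_model T E Theta) (W : probability (param_space Theta) R).
Implicit Types (theta : 'rV[R]_p) (tau : T -> \bar R).

Let ball theta (delta : R) : set (param_space Theta) :=
  [set u : param_space Theta |
    Theta u /\ (enorm ((u : 'rV[R]_p) - theta) < delta)%R].

(** The event of the second condition, outside which the weighted statistic is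
bounded from below. *)
Definition slow_growth nu n theta (delta J : R) : set T :=
  [set w | (n%:R^-1)%:E *
             ereal_inf [set llr M nu (nu + n) u w | u in
               [set u | Theta u /\ (enorm (u - theta) < delta)%R]] < J%:E].

Definition slow_growth_series (r : R) theta (delta J : R) : \bar R :=
  \sum_(1 <= n <oo) ((n%:R `^ (r - 1))%R)%:E *
    ereal_sup (range (fun nu : nat =>
      mu_ext (Pchange M nu theta) (slow_growth nu n theta delta J))).

(** Keep, in the statistic, only the change point nu and the parameters of the
ball: on the complement of [slow_growth] each of these likelihood ratios is at
least e^(n J). *)
Lemma wsr_ge nu n theta (delta J : R) w : (1 <= n)%N ->
  ~ slow_growth nu n theta delta J w ->
  (expR (n%:R * J))%:E * W (ball theta delta) <= wsr M W (nu + n) w.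
Proof.
move=> n1 /negP; rewrite -leNgt lee_pdivlMl ?ltr0n// -EFinM => inf_ge.
have mb := @measurable_param_ball R p Theta theta delta.
have <- : \int[W]_(u in (Theta : set (param_space Theta)))
    (\1_(ball theta delta) u)%:E = W (ball theta delta).
  rewrite integral_indic//; last exact: measurable_Theta.
  by congr (W _); apply/setIidl => u [].
apply: ge0_scale_integral_le => [|u _|u Tu]; first exact: expR_ge0.
  by rewrite lee_fin.
rewrite indicE; case: (boolP (u \in _)) => [/set_mem bu|_]; last first.
  by rewrite mule0; apply: sume_ge0 => k _; exact: lr_prod_ge0.
rewrite mule1.
apply: (@le_trans _ _ (lr_prod M nu (nu + n) u w)).
  rewrite -le_llr//; apply: le_trans inf_ge _; apply: ereal_inf_lbound.
  by exists u.
rewrite (bigD1_seq nu) ?iota_uniq ?mem_index_iota//=; last first.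
  by rewrite -addn1 leq_add2l.
by rewrite leeDl// sume_ge0// => k _; exact: lr_prod_ge0.
Qed.

Lemma wsr_time_tail nu n theta (delta J a om : R) : Theta theta -> (1 <= n)%N ->
  (0 < om)%R -> om%:E <= W (ball theta delta) -> (a <= n%:R * J + ln om)%R ->
  Pchange M nu theta [set w | (nu + n)%:R%:E < wsr_time M W a w] <=
  mu_ext (Pchange M nu theta) (slow_growth nu n theta delta J).
Proof.
move=> th n1 om0 omW aJ.
have st := wsr_time_stopping M W a.
rewrite -measurable_mu_extE; last first.
  exact (natural_filtration_measurable (obs_measurable M) (stopping_gt st (n:=(nu + n)%N))).
apply: le_mu_ext => w /=; rewrite ltNge => /negP tn; apply: contrapT => /(wsr_ge n1).
move=> wge; apply: tn; apply/wsr_time_le; exists (nu + n)%N.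
  by rewrite leqnn andbT (leq_trans n1)// leq_addl.
apply: le_trans wge; apply: (@le_trans _ _ ((expR (n%:R * J))%:E * om%:E)).
  rewrite -EFinM lee_fin; apply: (@le_trans _ _ (expR (n%:R * J + ln om))).
    by rewrite ler_expR.
  by rewrite expRD lnK.
by rewrite lee_wpmul2l// lee_fin expR_ge0.
Qed.

(** Summation by parts: the q-th power of the delay is at most N0^q plus the sum
over n >= N0 of ((n + 1)^q - n^q) 1_(tau > nu + n), and these increments are at
most (2^q - 1) n^(q - 1). *)
Lemma delay_moment_le (q : R) nu N0 theta tau (s : nat -> \bar R) (S : R) :
  (1 <= q)%R -> (1 <= N0)%N -> stopping_time M tau ->
  (forall n, 0 <= s n) ->
  (forall n, (N0 <= n)%N ->
     Pchange M nu theta [set w | (nu + n)%:R%:E < tau w] <= s n) ->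
  \sum_(1 <= n <oo) ((n%:R `^ (q - 1))%R)%:E * s n <= S%:E ->
  \int[Pchange M nu theta]_(w in [set w | nu%:R%:E < tau w])
     (tau w - nu%:R%:E) `^ q <=
  (N0%:R `^ q + (2 `^ q - 1) * S)%:E.
Proof.
move=> q1 N01 st s0 sP sS.
have q0 : (0 < q)%R by exact: lt_le_trans q1.
set P := Pchange M nu theta; set G := [set w | nu%:R%:E < tau w].
pose Gn n := [set w | (nu + n)%:R%:E < tau w].
have mgt n : measurable [set w | n%:R%:E < tau w].
  exact (natural_filtration_measurable (obs_measurable M) (stopping_gt st (n:=n))).
have mG : measurable G by exact: mgt.
have mGn n : measurable (Gn n) by exact: mgt.
pose c n : R := if (N0 <= n)%N then (n.+1%:R `^ q - n%:R `^ q)%R else 0%R.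
have c0 n : (0 <= c n)%R.
  rewrite /c; case: ifP => // _; rewrite subr_ge0 ge0_ler_powR ?nnegrE ?(ltW q0)//.
  by rewrite ler_nat.
pose h w := (N0%:R `^ q)%:E + \sum_(n <oo) (c n)%:E * (\1_(Gn n) w)%:E.
have t0 n w : 0 <= (c n)%:E * (\1_(Gn n) w)%:E by rewrite mule_ge0// lee_fin.
(* the increments telescope; letting K vary also covers tau w = +oo *)
have hK K w : (nu + K)%:R%:E <= tau w -> (K%:R `^ q)%:E <= h w.
  move=> Kt; have [KN|NK] := leqP K N0.
    apply: (@le_trans _ _ (N0%:R `^ q)%:E).
      by rewrite lee_fin ge0_ler_powR ?nnegrE ?(ltW q0)// ler_nat.
    by rewrite leeDl// nneseries_ge0.
  have -> : (K%:R `^ q)%:E =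
      (N0%:R `^ q)%:E + \sum_(0 <= n < K) (c n)%:E * (\1_(Gn n) w)%:E.
    rewrite (big_cat_nat (leq0n N0) (ltnW NK))/= [X in _ + (X + _)]big_nat big1; last first.
      by move=> n /andP[_ nN0]; rewrite /c leqNgt nN0/= mul0e.
    rewrite add0e (_ : \sum_(N0 <= n < K) _ =
       \sum_(N0 <= n < K) (n.+1%:R `^ q - n%:R `^ q)%:E); last first.
      rewrite [LHS]big_nat [RHS]big_nat; apply: eq_bigr => n /andP[Nn nK].
      rewrite /c Nn indicE mem_set ?mule1//=; apply: lt_le_trans Kt.
      by rewrite lte_fin ltr_nat ltn_add2l.
    by rewrite sumEFin (telescope_sumr (fun n => n%:R `^ q)%R (ltnW NK)) -EFinD addrC subrK.
  by rewrite leeD2l// nneseries_lim_ge.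
have gh w : G w -> (tau w - nu%:R%:E) `^ q <= h w.
  move=> Gw; have [+ _] := st => /(_ w)[ty|[n tn]]; last first.
    have nun : (nu <= n)%N by move: Gw; rewrite /G/= tn lte_fin ltr_nat => /ltnW.
    rewrite tn -EFinB -natrB// poweR_EFin; apply: hK.
    by rewrite subnKC// tn.
  rewrite (_ : h w = +oo) ?leey//; apply/eqyP => A A0.
  pose K := (Num.truncn A).+1.
  apply: (@le_trans _ _ (K%:R `^ q)%:E); last by apply: hK; rewrite ty leey.
  rewrite lee_fin (le_trans (ltW (truncnS_gt A)))//.
  rewrite -[leLHS]powRr1//; apply: ler_powR => //.
  by rewrite ler1n.
have mh : measurable_fun G h.
  apply: emeasurable_funD => //; apply: ge0_emeasurable_sum => n.
    by move=> w _ _; exact: t0.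
  move=> _; apply: emeasurable_funM => //.
  by apply/measurable_EFinP; apply: measurable_funTS; exact: measurable_indic.
have mg : measurable_fun G (fun w => (tau w - nu%:R%:E) `^ q).
  apply: measurable_funTS; apply: (measurableT_comp (measurable_poweR q)).
  apply: emeasurable_funB => //; exact: measurable_stopping st.
apply: (@le_trans _ _ (\int[P]_(w in G) h w)).
  by apply: ge0_le_integral => //= w Gw; exact: poweR_ge0.
rewrite /h ge0_integralD//; last 2 first.
- by move=> w _; rewrite nneseries_ge0.
- apply: ge0_emeasurable_sum => n; first by move=> w _ _; exact: t0.
  move=> _; apply: emeasurable_funM => //.
  by apply/measurable_EFinP; apply: measurable_funTS; exact: measurable_indic.
rewrite EFinD leeD//.
  rewrite integral_cst// -[leRHS]mule1 lee_wpmul2l ?lee_fin ?powR_ge0//.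
  exact: probability_le1.
rewrite integral_nneseries//; last first.
  move=> n; apply: emeasurable_funM => //.
  by apply/measurable_EFinP; apply: measurable_funTS; exact: measurable_indic.
have K0 : (0 <= 2 `^ q - 1 :> R)%R by exact: powR2_sub1_ge0 (ltW q0).
have i0 n : 0 <= \int[P]_(w in G) ((c n)%:E * (\1_(Gn n) w)%:E).
  by apply: integral_ge0 => w _; exact: t0.
apply: lime_le; first by apply: is_cvg_nneseries => n _ _; exact: i0.
apply: nearW => K /=.
apply: (@le_trans _ _ (\sum_(1 <= n < K) (2 `^ q - 1)%:E *
    ((n%:R `^ (q - 1))%:E * s n))).
  case: K => [|K]; first by rewrite !big_geq.
  rewrite big_ltn// [X in X + _](_ : _ = 0) ?add0e; last first.
    by apply: integral0_eq => w _; rewrite /c leqNgt N01/= mul0e.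
  rewrite [leLHS]big_nat [leRHS]big_nat; apply: lee_sum => n /andP[n1 _].
  rewrite ge0_integralZl//; last 2 first.
  - by apply/measurable_EFinP; apply: measurable_funTS; exact: measurable_indic.
  - by rewrite lee_fin.
  rewrite integral_indic// /c; case: (leqP N0 n) => [N0n|_]; last first.
    by rewrite mul0e mule_ge0// ?mule_ge0// lee_fin powR_ge0.
  rewrite muleA -EFinM; apply: lee_pmul => //.
  - by rewrite lee_fin; have := c0 n; rewrite /c N0n.
  - by rewrite lee_fin; exact: powR_succ_sub_le.
  apply: le_trans (sP _ N0n); apply: le_measure; rewrite ?inE//.
  exact: measurableI.
rewrite -ge0_sume_distrr; last by move=> n _; rewrite mule_ge0// lee_fin powR_ge0.
rewrite EFinM lee_wpmul2l ?lee_fin//; apply: le_trans sS.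
by apply: nneseries_lim_ge => n _ _; rewrite mule_ge0// lee_fin powR_ge0.
Qed.

Lemma risk_le (q : R) nu theta tau (x y : R) : Theta theta ->
  stopping_time M tau ->
  \int[Pchange M nu theta]_(w in [set w | nu%:R%:E < tau w])
     (tau w - nu%:R%:E) `^ q <= y%:E ->
  Pinf M [set w | tau w <= nu%:R%:E] <= x%:E -> (x < 1)%R -> (0 <= y)%R ->
  risk M q nu theta tau <= (y / (1 - x))%:E.
Proof.
move=> th st Iy Px x1 y0; rewrite /risk.
set P := Pchange M nu theta in Iy *; set G := [set w | nu%:R%:E < tau w] in Iy *.
have mG : measurable G.
  exact (natural_filtration_measurable (obs_measurable M) (stopping_gt st (n:=nu))).
have mle n : measurable [set w | tau w <= n%:R%:E].
  exact (natural_filtration_measurable (obs_measurable M) (stopping_le st (n:=n))).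
have PG : (1 - x)%:E <= P G.
  have -> : G = ~` [set w | tau w <= nu%:R%:E].
    by apply/seteqP; split=> w /=; rewrite /G/= ltNge => /negP.
  rewrite probability_setC// EFinB leeB//.
  by rewrite /P (Pchange_past th (leqnn nu))//; exact: stopping_le.
have PF : P G \is a fin_num by exact: fin_num_measure.
case: (P G) PF PG => // g _ PG; rewrite lee_fin in PG.
have x0 : (0 < 1 - x)%R by rewrite subr_gt0.
have g0 : (0 < g)%R by exact: lt_le_trans PG.
rewrite inver gt_eqF// lee_pdivrMr//; apply: le_trans Iy _.
by rewrite -EFinM lee_fin -mulrA ler_peMr// mulrC ler_pdivlMr// mul1r.
Qed.

Lemma wsr_risk_le (r q : R) nu N0 theta (delta J a om S kappa : R) :
  (1 <= q <= r)%R -> (1 <= N0)%N -> Theta theta ->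
  (0 <= J)%R -> (0 < om)%R -> om%:E <= W (ball theta delta) ->
  (a <= N0%:R * J + ln om)%R ->
  slow_growth_series r theta delta J <= S%:E ->
  Pinf M [set w | wsr_time M W a w <= nu%:R%:E] <= kappa%:E -> (kappa < 1)%R ->
  risk M q nu theta (wsr_time M W a) <=
    ((N0%:R `^ q + (2 `^ q - 1) * S) / (1 - kappa))%:E.
Proof.
move=> /andP[q1 qr] N01 th J0 om0 omW aJ SS Pk k1.
have st := wsr_time_stopping M W a.
pose s n := ereal_sup (range (fun nu : nat =>
      mu_ext (Pchange M nu theta) (slow_growth nu n theta delta J))).
have s0 n : 0 <= s n.
  apply: (@le_trans _ _ (mu_ext (Pchange M 0%N theta) (slow_growth 0%N n theta delta J))).
    by apply: mu_ext_ge0.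
  by apply: ereal_sup_ubound; exists 0%N.
have sS : \sum_(1 <= n <oo) ((n%:R `^ (q - 1))%R)%:E * s n <= S%:E.
  apply: lime_le.
    by apply: is_cvg_nneseries => n _ _; rewrite mule_ge0// lee_fin powR_ge0.
  apply: nearW => K /=; apply: le_trans SS.
  apply: (@le_trans _ _ (\sum_(1 <= n < K) (n%:R `^ (r - 1))%:E * s n)).
    rewrite [leLHS]big_nat [leRHS]big_nat; apply: lee_sum => n /andP[n1 _].
    apply: lee_wpmul2r; first exact: s0.
    by rewrite lee_fin; apply: ler_powR; [rewrite ler1n|rewrite lerB].
  by apply: nneseries_lim_ge => n _ _; rewrite mule_ge0// lee_fin powR_ge0.
have S0 : (0 <= S)%R.
  rewrite -lee_fin; apply: le_trans sS; apply: nneseries_ge0 => n _ _.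
  by rewrite mule_ge0// lee_fin powR_ge0.
apply: risk_le => //.
  apply: (delay_moment_le (s := s)) => // n N0n.
  apply: (@le_trans _ _ (mu_ext (Pchange M nu theta) (slow_growth nu n theta delta J))).
    apply: (wsr_time_tail nu th (leq_trans N01 N0n) om0 omW).
    by apply: le_trans aJ _; rewrite lerD2r ler_wpM2r// ler_nat.
  by apply: ereal_sup_ubound; exists nu.
rewrite addr_ge0 ?powR_ge0// mulr_ge0// powR2_sub1_ge0//.
exact: le_trans q1.
Qed.

(** If the series were infinite for every delta > 0, its limit at 0 would be
infinite. *)
Lemma condition2_series r I theta (eps : R) : Theta theta -> (0 < eps)%R ->
  condition2 M r I ->
  exists2 delta : R, (0 < delta)%R &
    slow_growth_series r theta delta (I theta - eps) < +oo.
Proof.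
move=> th eps0 /(_ theta eps th eps0) lim_lt.
apply: contrapT => nex.
have Sy delta : (0 < delta)%R -> slow_growth_series r theta delta (I theta - eps) = +oo.
  move=> d0; apply/eqP; rewrite -leye_eq leNgt; apply/negP => Slt.
  by apply: nex; exists delta.
move: lim_lt; rewrite [X in X < _](_ : _ = +oo) ?ltxx//.
apply: lim_near_cst; first exact: ereal_hausdorff.
near=> delta; apply: Sy; near: delta.
exact: nbhs_right_gt.
Unshelve. all: by end_near. Qed.

End UpperBound.

(** * Limits as beta tends to 0 *)

Lemma near0_norm_ln_ge (R : realType) (A : R) :
  \forall beta \near (0 : R)^'+, A <= `|ln beta|.
Proof.
near=> beta; have b0 : 0 < beta by near: beta; exact: nbhs_right_gt.
have bA : beta < expR (- A) by near: beta; apply: nbhs_right_lt; exact: expR_gt0.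
have : ln beta <= - A by rewrite -[leRHS]expRK ler_ln ?posrE ?expR_gt0// ltW.
by move=> h; rewrite ler_normr; apply/orP; right; lra.
Unshelve. all: by end_near. Qed.

Lemma near0_lt (R : realType) (x : R) : 0 < x -> \forall beta \near (0 : R)^'+, 0 < beta < x.
Proof.
move=> x0; near=> beta; apply/andP; split; near: beta.
  exact: nbhs_right_gt.
exact: nbhs_right_lt.
Unshelve. all: by end_near. Qed.

Lemma cvg_near_lt (R : realType) (f : R -> R) (l x : R) : l < x ->
  f beta @[beta --> 0^'+] --> l -> \forall beta \near 0^'+, f beta < x.
Proof. by move=> lx /cvgr_lt; apply. Qed.

Lemma cvg_near_gt (R : realType) (f : R -> R) (l x : R) : x < l ->
  f beta @[beta --> 0^'+] --> l -> \forall beta \near 0^'+, x < f beta.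
Proof. by move=> lx /cvgr_gt; apply. Qed.

(** The limit makes the probability (1 - rho)^(m + 1) at most sqrt(beta), hence
(m + 1) |ln (1 - rho)| >= |ln beta| / 2, while |ln (1 - rho)| <= 2 rho tends
to 0. *)
Lemma window_length_growth (R : realType) (rho : R -> R) (m : R -> nat) (K : R) :
  (forall beta, 0 < beta < 1 -> 0 < rho beta < 1) ->
  rho beta @[beta --> 0^'+] --> (0 : R) ->
  `|ln (beta + (1 - rho beta) ^+ (m beta + 1))| / `|ln beta|
    @[beta --> 0^'+] --> (1 : R) ->
  \forall beta \near 0^'+, K * `|ln beta| <= (m beta)%:R.
Proof.
move=> rho01 rho0 lim1.
pose K1 := `|K| + 1.
have K1p : 1 <= K1 by rewrite lerDr.
near=> beta.
have b01 : 0 < beta < 1 by near: beta; exact: near0_lt.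
have /andP[b0 b1] := b01.
have /andP[r0 r1] := rho01 _ b01.
have L2 : 2 <= `|ln beta| by near: beta; exact: near0_norm_ln_ge.
have rK : rho beta < (8 * K1)^-1.
  by near: beta; apply: cvg_near_lt rho0; rewrite invr_gt0; lra.
have half : 2^-1 < `|ln (beta + (1 - rho beta) ^+ (m beta + 1))| / `|ln beta|.
  by near: beta; apply: cvg_near_gt lim1; lra.
set L := `|ln beta| in L2 half *.
have x0 : 0 < (1 - rho beta) ^+ (m beta + 1) by rewrite exprn_gt0// subr_gt0.
have x1 : (1 - rho beta) ^+ (m beta + 1) <= 1.
  by apply: exprn_ile1; lra.
set x := (1 - rho beta) ^+ _ in x0 x1 half *.
have ln_al : ln (beta + x) < L / 2.
  have : ln (1 + (beta + x - 1)) <= beta + x - 1 by apply: le_ln1Dx; lra.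
  rewrite addrC subrK => h; lra.
have lnx : ln x <= - (L / 2).
  have lnxal : ln x <= ln (beta + x) by rewrite ler_ln ?posrE//; lra.
  move: half; rewrite ltr_pdivlMr; last lra.
  have [al0|al0] := leP 0 (ln (beta + x)); first by rewrite ger0_norm//; lra.
  by rewrite ltr0_norm//; lra.
have y0 : 0 < 1 - rho beta by lra.
have rho_le : rho beta * (8 * K1) <= 1.
  by rewrite -ler_pdivlMr ?mul1r ?(ltW rK)//; lra.
have rhoh : 2 * rho beta <= 1 by nra.
have lny : - (2 * rho beta) <= ln (1 - rho beta).
  have : ln (1 + ((1 - rho beta)^-1 - 1)) <= (1 - rho beta)^-1 - 1.
    by apply: le_ln1Dx; have := invr_gt0 (1 - rho beta); rewrite y0 => h; lra.
  rewrite addrC subrK lnV ?posrE// => h.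
  have : (1 - rho beta)^-1 - 1 <= 2 * rho beta.
    rewrite lerBlDr -[leLHS]mul1r ler_pdivrMr//; nra.
  lra.
have : L / 2 <= (m beta + 1)%:R * (2 * rho beta).
  move: lnx; rewrite /x lnXn// -mulr_natl.
  have m0 : 0 <= (m beta + 1)%:R :> R by [].
  nra.
rewrite natrD; set mm := (m beta)%:R => hm.
have mm0 : 0 <= mm by rewrite /mm.
have h2 : 2 * K1 * L <= mm + 1.
  have : L / 2 * (8 * K1) <= (mm + 1) * 2 by nra.
  lra.
have KK : K <= K1 by rewrite /K1; have := ler_norm K; lra.
nra.
Unshelve. all: by end_near. Qed.

Lemma equiv0_sandwich (R : realType) (rate : R -> R) (f : R -> \bar R) :
  (\forall beta \near 0^'+, 0 < rate beta) ->
  (forall eta, 0 < eta < 1 -> \forall beta \near 0^'+,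
     (((1 - eta) * rate beta)%:E <= f beta <= ((1 + eta) * rate beta)%:E)%E) ->
  equiv0 f (fun beta => (rate beta)%:E) /\ equiv0 (fun beta => (rate beta)%:E) f.
Proof.
move=> rate0 sw.
pose g beta := fine (f beta) / rate beta.
have fE : \forall beta \near 0^'+, [/\ 0 < rate beta, 0 < g beta &
    f beta = (g beta * rate beta)%:E].
  have h01 : 0 < (2^-1 : R) < 1 by lra.
  apply: filterS2 rate0 (sw _ h01) => beta r0.
  rewrite /g; case: (f beta) => [y| |] /andP[]//; rewrite !lee_fin => yl yu.
  have y0 : 0 < y by nra.
  by split=> //=; [rewrite divr_gt0|rewrite divfK ?gt_eqF].
have g1 : g beta @[beta --> 0^'+] --> (1 : R).
  apply/cvgrPdist_le => eps eps0; pose eta := Num.min eps 2^-1.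
  have eta01 : 0 < eta < 1.
    apply/andP; split; first by rewrite lt_min eps0/=; lra.
    by rewrite gt_min; apply/orP; right; lra.
  have := sw _ eta01; apply: filterS2 fE => beta [r0 _ ->].
  rewrite !lee_fin !(ler_pM2r r0) => /andP[gl gu].
  have etaeps : eta <= eps by rewrite ge_min lexx.
  by rewrite ler_norml; lra.
have rg (x y : R) : y != 0 -> y / (x * y) = x^-1.
  by move=> y0; rewrite invfM mulrCA mulfV// mulr1.
have Eg : (g beta)%:E @[beta --> 0^'+] --> 1%E.
  by apply/fine_cvgP; split => //; exact: nearW.
have EgV : ((g beta)^-1)%:E @[beta --> 0^'+] --> 1%E.
  apply/fine_cvgP; split; first exact: nearW.
  by rewrite /= -[X in _ --> X]invr1; apply: cvgV => //; exact: oner_neq0.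
split.
- apply: cvg_trans Eg; apply: near_eq_cvg; apply: filterS fE => beta [r0 _ ->].
  rewrite inver gt_eqF//.
  change ((g beta)%:E = (g beta * rate beta / rate beta)%:E).
  by rewrite mulfK// gt_eqF.
- apply: cvg_trans EgV; apply: near_eq_cvg; apply: filterS fE => beta [r0 g0 ->].
  rewrite inver gt_eqF; last exact: (mulr_gt0 g0 r0).
  change (((g beta)^-1)%:E = (rate beta / (g beta * rate beta))%:E).
  by rewrite rg// gt_eqF.
Qed.

(** * Asymptotic bounds of the risk *)

Section Asymptotics.
Context (R : realType) (d d' : measure_display) (T : measurableType d)
  (E : measurableType d') (p : nat) (Theta : set 'rV[R]_p)
  (M : changepoint_model T E Theta) (I : 'rV[R]_p -> R) (theta : 'rV[R]_p)
  (Theta_theta : Theta theta) (I_gt0 : 0 < I theta).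

(** [risk_ge] with N just below (1 - 3 eps) |ln beta| / I and C = (1 + eps) I N:
then e^C beta <= e^(- eps |ln beta|) vanishes, and nu + N <= m since m grows
faster than |ln beta|. *)
Lemma class_risk_lower (l m : R -> nat) (q s : R) (nu : nat) :
  (forall beta, 0 < beta < 1 -> (1 <= l beta)%N) ->
  (forall K : R, \forall beta \near 0^'+, K * `|ln beta| <= (m beta)%:R) ->
  0 <= q -> condition1 M I -> 0 < s < 1 ->
  \forall beta \near 0^'+, forall tau, class_H M beta (l beta) (m beta) tau ->
    ((s `^ (q + 1) * (`|ln beta| / I theta) `^ q)%:E <= risk M q nu theta tau)%E.
Proof.
move=> l1 growth q0 cond1 /andP[s0 s1].
(* N will be at least (1 - 4 eps) |ln beta| / I = s |ln beta| / I *)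
pose eps := (1 - s) / 4.
have eps0 : 0 < eps by rewrite /eps; lra.
have epss : s = 1 - 4 * eps by rewrite /eps; lra.
have [N1 HN1] : exists N1 : nat, forall N, (N1 <= N)%N ->
    (Pchange M nu theta [set w | (((1 + eps) * I theta * N%:R)%:E <=
      llr M nu (nu + N) theta w)%E] <= (eps / 3)%:E)%E.
  have e30 : 0 < eps / 3 by lra.
  have /fine_cvgP[ffin /cvgr_lt/(_ _ e30) fsmall] :=
    condition1_llr nu eps0 Theta_theta cond1.
  have [N1 _ HN1] := filterI ffin fsmall.
  exists N1 => N /HN1[/= Pfin Plt].
  by rewrite -(fineK Pfin) lee_fin ltW.
near=> beta => tau Htau.
have b01 : 0 < beta < 1 by near: beta; exact: near0_lt.
have be : beta <= eps / 3.
  have /andP[_] : 0 < beta < eps / 3 by near: beta; apply: near0_lt; lra.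
  exact: ltW.
have /andP[b0 b1] := b01.
have LE : `|ln beta| = - ln beta by rewrite ltr0_norm// ln_lt0.
have L1 : I theta / eps <= `|ln beta| by near: beta; exact: near0_norm_ln_ge.
have L2 : N1%:R * I theta / s <= `|ln beta| by near: beta; exact: near0_norm_ln_ge.
have L3 : - ln (eps / 3) / eps <= `|ln beta| by near: beta; exact: near0_norm_ln_ge.
have L4 : nu%:R <= `|ln beta| by near: beta; exact: near0_norm_ln_ge.
have L5 : ((1 - 3 * eps) / I theta + 1) * `|ln beta| <= (m beta)%:R by near: beta.
set L := `|ln beta| in LE L1 L2 L3 L4 L5 *.
have L0 : 0 <= L by exact: normr_ge0.
pose y := (1 - 3 * eps) * L / I theta.
have y0 : 0 <= y by rewrite /y divr_ge0 ?(ltW I_gt0)// mulr_ge0//; lra.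
pose N := Num.truncn y.
have Ny : N%:R <= y by rewrite truncn_le.
have yN : y < N%:R + 1 by rewrite natr1; exact: truncnS_gt.
have LI : 1 <= eps * (L / I theta).
  by rewrite mulrA ler_pdivlMr// mul1r mulrC -ler_pdivrMr.
have sN : s * (L / I theta) <= N%:R.
  move: yN; rewrite /y -mulrA => yN; rewrite epss; lra.
have N1N : (N1 <= N)%N.
  rewrite -(ler_nat R); apply: le_trans sN.
  rewrite mulrA ler_pdivlMr//; move: L2; rewrite ler_pdivrMr//; lra.
have nuN : (nu + N <= m beta)%N.
  rewrite -(ler_nat R) natrD; apply: le_trans L5.
  by rewrite mulrDl mul1r addrC lerD// mulrAC.
pose C := (1 + eps) * I theta * N%:R.
have CL : C <= (1 - eps) * L.
  have IN : I theta * N%:R <= (1 - 3 * eps) * L.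
    by rewrite mulrC -ler_pdivlMr.
  have : (1 + eps) * (I theta * N%:R) <= (1 + eps) * ((1 - 3 * eps) * L).
    by rewrite ler_pM2l//; lra.
  rewrite /C -mulrA => h; nra.
have eCb : expR C * beta <= eps / 3.
  rewrite -[X in _ * X]lnK ?posrE// -expRD -[leRHS]lnK ?posrE; last lra.
  rewrite ler_expR; move: L3; rewrite ler_pdivrMr// => L3; nra.
have st : stopping_time M tau by case: Htau.
have early := class_H_early (l1 _ b01) Htau.
have Pnu : (Pinf M [set w | tau w <= nu%:R%:E] <= beta%:E)%E.
  apply: le_trans early; apply: le_measure; rewrite ?inE.
  - exact (natural_filtration_measurable (obs_measurable M) (stopping_le st (n:=nu))).
  - exact (natural_filtration_measurable (obs_measurable M) (stopping_le st (n:=m beta))).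
  - move=> w /= tn; apply: le_trans tn _; rewrite lee_fin ler_nat.
    exact: leq_trans (leq_addr N nu) nuN.
have Pdet : (Pchange M nu theta [set w | nu%:R%:E < tau w /\
    tau w <= (nu + N)%:R%:E] <= (eps / 3 + eps / 3)%:E)%E.
  apply: le_trans (Pchange_detect_le C (l1 _ b01) Htau Theta_theta nuN) _.
  by rewrite EFinD leeD//; exact: HN1.
apply: le_trans (risk_ge q0 Theta_theta st Pnu Pdet b1).
rewrite lee_fin powRD; last by apply/implyP => _; rewrite gt_eqF.
rewrite powRr1 ?(ltW s0)// mulrAC -powRM ?(ltW s0) ?divr_ge0 ?(ltW I_gt0)//.
rewrite ler_pM ?powR_ge0 ?(ltW s0)//.
  have LI0 : 0 <= L / I theta by rewrite divr_ge0 ?(ltW I_gt0).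
  by apply: ge0_ler_powR => //; rewrite nnegrE// mulr_ge0 ?(ltW s0).
lra.
Unshelve. all: by end_near. Qed.

(** [wsr_risk_le] at the growth rate J = I / s. Each of the three estimates
a <= s |ln beta|, N0 <= s a / I + const, and 1 / (1 - kappa) <= s costs a factor
close to 1; together with the absorption of the additive constants into further
such factors they give the exponent 3 q + 2. *)
Lemma wsr_risk_upper (W : probability (param_space Theta) R) (r q s : R)
    (a : R -> R) (k : R -> nat) :
  (forall delta : R, 0 < delta ->
     (0 < W [set u : param_space Theta |
               Theta u /\ (enorm ((u : 'rV[R]_p) - theta) < delta)%R])%E) ->
  1 <= q <= r -> condition2 M r I -> 1 < s ->
  (forall t : R, 1 < t -> \forall beta \near 0^'+, a beta <= t * `|ln beta|) ->
  (forall c : R, 0 < c -> \forall beta \near 0^'+, forall nu, (nu <= k beta)%N ->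
    (Pinf M [set w | wsr_time M W (a beta) w <= nu%:R%:E] <= c%:E)%E) ->
  \forall beta \near 0^'+, forall nu, (nu <= k beta)%N ->
    (risk M q nu theta (wsr_time M W (a beta)) <=
      (s `^ (3 * q + 2) * (`|ln beta| / I theta) `^ q)%:E)%E.
Proof.
move=> Wpos qr cond2 s1 alim Plim.
have /andP[q1 _] := qr.
have s0 : 0 < s by lra.
pose J := I theta / s.
have J0 : 0 < J by exact: divr_gt0.
pose eps := I theta - J.
have eps0 : 0 < eps by rewrite subr_gt0 ltr_pdivrMr// ltr_pMr.
have [delta delta0 Slt] := condition2_series Theta_theta eps0 cond2.
rewrite (_ : I theta - eps = J) in Slt; last by rewrite /eps opprB addrC subrK.
pose S := fine (slow_growth_series M r theta delta J).
have Sge0 : (0 <= slow_growth_series M r theta delta J)%E.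
  apply: nneseries_ge0 => n _ _; rewrite mule_ge0 ?lee_fin ?powR_ge0//.
  apply: (@le_trans _ _ (mu_ext (Pchange M 0%N theta) (slow_growth M 0%N n theta delta J))).
    exact: mu_ext_ge0.
  by apply: ereal_sup_ubound; exists 0%N.
have SE : (slow_growth_series M r theta delta J <= S%:E)%E.
  by rewrite /S fineK// ge0_fin_numE.
have S0 : 0 <= S by exact: fine_ge0.
have mb := @measurable_param_ball R p Theta theta delta.
pose om := fine (W [set u : param_space Theta |
               Theta u /\ (enorm ((u : 'rV[R]_p) - theta) < delta)%R]).
have omE : om%:E = W [set u : param_space Theta |
               Theta u /\ (enorm ((u : 'rV[R]_p) - theta) < delta)%R].
  by rewrite fineK//; exact: fin_num_measure.
have om0 : 0 < om by rewrite -lte_fin omE; exact: Wpos.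
pose A := (2 `^ q - 1) * S.
have A0 : 0 <= A by rewrite mulr_ge0// powR2_sub1_ge0//; lra.
have c0 : 0 < 1 - s^-1 by rewrite subr_gt0 invf_lt1.
near=> beta => nu nuk.
have Pnu : (Pinf M [set w | wsr_time M W (a beta) w <= nu%:R%:E] <= (1 - s^-1)%:E)%E.
  by move: nu nuk; near: beta; exact: Plim.
have aL : a beta <= s * `|ln beta| by near: beta; exact: alim.
have L1 : (s * `|ln om| + I theta) / (s ^+ 2 * (s - 1)) <= `|ln beta|.
  by near: beta; exact: near0_norm_ln_ge.
have L2 : (A / (s - 1) + 1) * I theta / s ^+ 3 <= `|ln beta|.
  by near: beta; exact: near0_norm_ln_ge.
set L := `|ln beta| in aL L1 L2 *.
have L0 : 0 <= L by exact: normr_ge0.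
(* X bounds N0 from above, and its power X^q absorbs the constant A *)
pose X := s ^+ 3 * (L / I theta).
have X1 : A / (s - 1) + 1 <= X.
  rewrite /X mulrA ler_pdivlMr//; move: L2; rewrite ler_pdivrMr ?exprn_gt0//; lra.
have X1' : 1 <= X.
  by apply: le_trans X1; rewrite lerDr divr_ge0//; lra.
pose y := (a beta - ln om) / J.
pose N0 := (Num.truncn y).+1.
have N0X : N0%:R <= X.
  have [y0|y0] := ltP y 0.
    rewrite /N0 (_ : Num.truncn y = 0%N)//; apply/truncn0Pn.
    by rewrite -ltNge (lt_trans y0).
  rewrite /N0 -natr1; apply: (@le_trans _ _ (y + 1)).
    by rewrite lerD2r truncn_le.
  have lnom : - ln om <= `|ln om| by rewrite -normrN ler_norm.
  rewrite -lerBrDr /y ler_pdivrMr//.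
  have -> : (X - 1) * J = s ^+ 2 * L - I theta / s.
    by rewrite /X /J; field; rewrite (gt_eqF s0) (gt_eqF I_gt0).
  have : `|ln om| + I theta / s <= s * (s - 1) * L.
    rewrite -(ler_pM2l s0) mulrDr [s * (_ / s)]mulrC divfK ?gt_eqF//.
    move: L1; rewrite ler_pdivrMr; last by rewrite mulr_gt0 ?exprn_gt0 ?subr_gt0.
    by move=> h; apply: le_trans h _; rewrite le_eqVlt; apply/orP; left; apply/eqP; ring.
  move=> h; have -> : s ^+ 2 * L = s * (s - 1) * L + s * L by ring.
  lra.
have aJ : a beta <= N0%:R * J + ln om.
  by rewrite -lerBlDr -ler_pdivrMr// ltW// truncnS_gt.
have ci : 1 - s^-1 < 1 by rewrite gtrBl invr_gt0.
have omW : (om%:E <= W [set u : param_space Theta |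
               Theta u /\ (enorm ((u : 'rV[R]_p) - theta) < delta)%R])%E.
  by rewrite omE.
apply: le_trans (wsr_risk_le qr (ltn0Sn _) Theta_theta (ltW J0) om0 omW aJ SE Pnu ci) _.
rewrite lee_fin subKr invrK -/A -/N0.
have q0 : 0 <= q by lra.
have N0q : N0%:R `^ q <= X `^ q.
  by rewrite ge0_ler_powR ?nnegrE//; lra.
have XX : X <= X `^ q.
  by rewrite -[leLHS]powRr1; [exact: ler_powR|lra].
have AX : A <= (s - 1) * X `^ q.
  rewrite mulrC -ler_pdivrMr ?subr_gt0//; lra.
have sX : s `^ (3 * q + 2) * (L / I theta) `^ q = s * X `^ q * s.
  have LI0 : 0 <= L / I theta by rewrite divr_ge0 ?(ltW I_gt0).
  have s30 : 0 <= s ^+ 3 by rewrite exprn_ge0 ?(ltW s0).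
  rewrite /X (powRM _ s30 LI0).
  rewrite -powR_mulrn ?(ltW s0)// -powRrM powRD; last by rewrite (gt_eqF s0) implybT.
  by rewrite [s `^ 2]powR_mulrn ?(ltW s0)//; ring.
rewrite sX ler_pM2r//.
rewrite (_ : s * X `^ q = X `^ q + (s - 1) * X `^ q); last by ring.
exact: lerD.
Unshelve. all: by end_near. Qed.

End Asymptotics.

(** * Asymptotic optimality *)

Lemma threshold_le (R : realType) (rho alpha : R) : 0 < rho < 1 -> 0 < alpha < 1 ->
  ln ((1 - alpha) / (rho * alpha)) <= `|ln rho| + `|ln alpha|.
Proof.
move=> /andP[r0 r1] /andP[a0 a1].
rewrite ln_div ?posrE ?mulr_gt0 ?subr_gt0// lnM ?posrE//.
have h : ln (1 - alpha) <= 0 by apply: ln_le0; lra.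
rewrite (ltr0_norm (ln_lt0 _)) ?r0// (ltr0_norm (ln_lt0 _)) ?a0//; lra.
Qed.

Lemma powR_root (R : realType) (x c : R) : 0 <= x -> 0 < c -> (x `^ c^-1) `^ c = x.
Proof. by move=> x0 c0; rewrite -powRrM mulVf ?gt_eqF// powRr1. Qed.

Lemma powR_lt1 (R : realType) (x c : R) : 0 < x < 1 -> 0 < c -> x `^ c < 1.
Proof.
move=> /andP[x0 x1] c0; have := gt0_ltr_powR c0 (x := x) (y := 1).
by rewrite !nnegrE (ltW x0) ler01 x1 powR1; apply.
Qed.

Lemma powR_gt1 (R : realType) (x c : R) : 1 < x -> 0 < c -> 1 < x `^ c.
Proof.
move=> x1 c0; have := gt0_ltr_powR c0 (x := 1) (y := x).
by rewrite !nnegrE ler01 x1 powR1 (ltW (lt_trans ltr01 x1)); apply.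
Qed.

(** The infimum over a class containing t is squeezed between a lower bound valid
for the whole class and the loss of t itself. *)
Lemma equiv0_optimal (R : realType) (X : Type) (H : R -> set X) (t : R -> X)
    (loss : R -> X -> \bar R) (rate : R -> R) :
  (\forall beta \near 0^'+, 0 < rate beta) ->
  (\forall beta \near 0^'+, H beta (t beta)) ->
  (forall eta, 0 < eta < 1 -> \forall beta \near 0^'+,
     (forall x, H beta x -> (((1 - eta) * rate beta)%:E <= loss beta x)%E) /\
     (loss beta (t beta) <= ((1 + eta) * rate beta)%:E)%E) ->
  equiv0 (fun beta => ereal_inf [set loss beta x | x in H beta])
    (fun beta => (rate beta)%:E) /\
  equiv0 (fun beta => (rate beta)%:E) (fun beta => loss beta (t beta)).
Proof.
move=> rate0 Ht bounds; split.
- apply: (equiv0_sandwich rate0 _).1 => eta /bounds.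
  apply: filterS2 Ht => beta Htb [lo up]; apply/andP; split.
    by apply: le_ereal_inf_tmp => _ [x Hx <-]; exact: lo.
  by apply: le_trans up; apply: ereal_inf_lbound; exists (t beta).
- apply: (equiv0_sandwich rate0 _).2 => eta /bounds.
  by apply: filterS2 Ht => beta Htb [lo up]; rewrite lo.
Qed.

Theorem theorem5 (R : realType) (d d' : measure_display)
  (T : measurableType d) (E : measurableType d') (p : nat)
  (Theta : set 'rV[R]_p) (M : changepoint_model T E Theta)
  (W : probability (param_space Theta) R)
  (W_Theta : W (Theta : set (param_space Theta)) = 1%E)
  (W_pos : forall (theta : 'rV[R]_p) (delta : R), Theta theta -> 0 < delta ->
     (0 < W [set u : param_space Theta |
               Theta u /\ (enorm ((u : 'rV[R]_p) - theta) < delta)%R])%E)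
  (rho1 cdelta : R -> R)
  (rho1_range : forall beta, 0 < beta < 1 -> 0 < rho1 beta < 1)
  (cdelta_range : forall beta, 0 < beta < 1 -> 0 < cdelta beta < 1)
  (rho1_cdelta_lim : rho1 beta + cdelta beta @[beta --> 0^'+] --> (0 : R))
  (rho1_cdelta_log :
     (`|ln (rho1 beta)| + `|ln (cdelta beta)|) / `|ln beta|
       @[beta --> 0^'+] --> (0 : R))
  (r : R) (r_ge1 : 1 <= r)
  (l m : R -> nat)
  (l_ge1 : forall beta, 0 < beta < 1 -> (1 <= l beta)%N)
  (m_ge1 : forall beta, 0 < beta < 1 -> (1 <= m beta)%N) :
  let rho2 beta := cdelta beta * rho1 beta in
  let alpha1 beta := beta + (1 - rho1 beta) ^+ (m beta + 1) in
  let alpha2 beta :=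
    beta * (1 - rho2 beta) ^+ (l beta + m beta) / (1 + beta) in
  let kstar beta := (l beta + m beta)%N in
  let a beta := ln ((1 - alpha2 beta) / (rho2 beta * alpha2 beta)) in
  let Tb beta := wsr_time M W (a beta) in
  let H beta := class_H M beta (l beta) (m beta) in
  `|ln (alpha1 beta)| / `|ln beta| @[beta --> 0^'+] --> (1 : R) ->
  `|ln (alpha2 beta)| / `|ln beta| @[beta --> 0^'+] --> (1 : R) ->
  alpha2 beta * rho2 beta * (kstar beta)%:R @[beta --> 0^'+] --> (0 : R) ->
  (forall beta, 0 < beta < 1 -> H beta (Tb beta)) /\
  (forall I : 'rV[R]_p -> R,
     (forall theta, Theta theta -> 0 < I theta) ->
     {within Theta, continuous I} ->
     condition1 M I ->
     condition2 M r I ->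
     forall q : R, 1 <= q <= r -> forall theta, Theta theta ->
       let rate beta := ((`|ln beta| / I theta) `^ q)%:E in
       (forall nu : nat,
          equiv0 (fun beta => ereal_inf [set risk M q nu theta tau
                                        | tau in H beta]) rate /\
          equiv0 rate (fun beta => risk M q nu theta (Tb beta))) /\
       (equiv0 (fun beta => ereal_inf [set max_risk M q (kstar beta) theta tau
                                      | tau in H beta]) rate /\
        equiv0 rate
          (fun beta => max_risk M q (kstar beta) theta (Tb beta)))).
Proof.
move=> rho2 alpha1 alpha2 kstar a Tb H lim_alpha1 lim_alpha2 lim_kstar.
have rho2_range beta : 0 < beta < 1 -> 0 < rho2 beta < 1.
  move=> b01; have /andP[? ?] := rho1_range _ b01.
  have /andP[? ?] := cdelta_range _ b01.
  by rewrite /rho2 mulr_gt0//= mulr_ilt1 ?ltW.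
have alpha2_range beta : 0 < beta < 1 -> 0 < alpha2 beta < 2^-1.
  move=> b01; have /andP[b0 b1] := b01; have /andP[r0 r1] := rho2_range _ b01.
  have x0 : 0 < (1 - rho2 beta) ^+ (l beta + m beta) by rewrite exprn_gt0// subr_gt0.
  have x1 : (1 - rho2 beta) ^+ (l beta + m beta) <= 1 by apply: exprn_ile1; lra.
  have b10 : 0 < 1 + beta by lra.
  by rewrite /alpha2 divr_gt0 ?mulr_gt0//= ltr_pdivrMr//; nra.
have H_T beta : 0 < beta < 1 -> H beta (Tb beta).
  by move=> b01; apply: wsr_class_H => //; exact: rho2_range.
split=> // I I_pos _ cond1 cond2 q qr theta th rate.
have /andP[q1 _] := qr.
have q0 : 0 <= q by lra.
have I0 := I_pos _ th.
have near01 : \forall beta \near (0 : R)^'+, 0 < beta < 1 by exact: near0_lt.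
have rho1_0 : rho1 beta @[beta --> 0^'+] --> (0 : R).
  apply: squeeze_cvgr rho1_cdelta_lim; last exact: cvg_cst.
  apply: filterS near01 => beta b01.
  have /andP[? _] := rho1_range _ b01; have /andP[? _] := cdelta_range _ b01.
  by apply/andP; split; lra.
have growth K : \forall beta \near 0^'+, K * `|ln beta| <= (m beta)%:R.
  exact: window_length_growth rho1_range rho1_0 lim_alpha1.
(* a = ln (1 - alpha2) - ln rho2 - ln alpha2, where the last term dominates *)
have a_le t : 1 < t -> \forall beta \near 0^'+, a beta <= t * `|ln beta|.
  move=> t1.
  have t0 : 0 < (t - 1) / 2 by lra.
  have t2 : 1 < 1 + (t - 1) / 2 by lra.
  near=> beta.
  have b01 : 0 < beta < 1 by near: beta.
  have L1 : 1 <= `|ln beta| by near: beta; exact: near0_norm_ln_ge.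
  have h1 : (`|ln (rho1 beta)| + `|ln (cdelta beta)|) / `|ln beta| < (t - 1) / 2.
    by near: beta; exact: cvg_near_lt rho1_cdelta_log.
  have h2 : `|ln (alpha2 beta)| / `|ln beta| < 1 + (t - 1) / 2.
    by near: beta; exact: cvg_near_lt lim_alpha2.
  have al : 0 < alpha2 beta < 1 by have /andP[? ?] := alpha2_range _ b01; lra.
  have /andP[r0 _] := rho1_range _ b01; have /andP[c0 _] := cdelta_range _ b01.
  apply: le_trans (threshold_le (rho2_range _ b01) al) _.
  have : `|ln (rho2 beta)| <= `|ln (rho1 beta)| + `|ln (cdelta beta)|.
    by rewrite /rho2 lnM ?posrE// addrC ler_normD.
  move: h1 h2; rewrite !ltr_pdivrMr; [|lra|lra]; nra.
have PT_le c : 0 < c -> \forall beta \near 0^'+, forall nu, (nu <= kstar beta)%N ->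
    (Pinf M [set w | Tb beta w <= nu%:R%:E] <= c%:E)%E.
  move=> c0; near=> beta => nu nuk.
  have b01 : 0 < beta < 1 by near: beta.
  have hk : alpha2 beta * rho2 beta * (kstar beta)%:R < c / 2.
    by near: beta; apply: cvg_near_lt lim_kstar; lra.
  have /andP[al0 al1] := alpha2_range _ b01.
  have /andP[r0 r1] := rho2_range _ b01.
  have al : 0 < alpha2 beta < 1 by lra.
  apply: le_trans (wsr_false_alarm_le M W_Theta _ r0 al) _.
  rewrite lee_fin mulrA ler_pdivrMr; last lra.
  have nk : nu%:R <= (kstar beta)%:R :> R by rewrite ler_nat.
  have : nu%:R * (rho2 beta * alpha2 beta) <= (kstar beta)%:R * (rho2 beta * alpha2 beta).
    by rewrite ler_wpM2r// mulr_ge0// ltW.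
  nra.
have rate0 : \forall beta \near 0^'+, 0 < (`|ln beta| / I theta) `^ q.
  apply: filterS (near0_norm_ln_ge 1) => beta L1.
  by rewrite powR_gt0// divr_gt0//; lra.
have lower nu eta : 0 < eta < 1 -> \forall beta \near 0^'+, forall tau, H beta tau ->
    (((1 - eta) * (`|ln beta| / I theta) `^ q)%:E <= risk M q nu theta tau)%E.
  move=> /andP[e0 e1].
  have qp : 0 < q + 1 by lra.
  have s01 : 0 < (1 - eta) `^ (q + 1)^-1 < 1.
    by rewrite powR_gt0 ?subr_gt0//= powR_lt1 ?invr_gt0//; lra.
  have := class_risk_lower th I0 nu l_ge1 growth q0 cond1 s01.
  rewrite powR_root ?subr_ge0 ?(ltW e1)//; exact.
have upper eta : 0 < eta < 1 -> \forall beta \near 0^'+, forall nu,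
    (nu <= kstar beta)%N ->
    (risk M q nu theta (Tb beta) <= ((1 + eta) * (`|ln beta| / I theta) `^ q)%:E)%E.
  move=> /andP[e0 e1].
  have qp : 0 < 3 * q + 2 by lra.
  have s1 : 1 < (1 + eta) `^ (3 * q + 2)^-1.
    by rewrite powR_gt1 ?invr_gt0//; lra.
  have := wsr_risk_upper th I0 (W_pos theta ^~ th) qr cond2 s1 a_le PT_le.
  by rewrite powR_root//; lra.
have nu_kstar nu : \forall beta \near 0^'+, (nu <= kstar beta)%N.
  apply: filterS2 (growth 1) (near0_norm_ln_ge nu%:R) => beta Lm nuL.
  rewrite -(ler_nat R); apply: le_trans nuL _; rewrite mul1r in Lm.
  by apply: le_trans Lm _; rewrite ler_nat leq_addl.
have max_ge K tau (c : R) : (c%:E <= risk M q 0 theta tau ->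
    c%:E <= max_risk M q K theta tau)%E.
  by move=> c_le; rewrite le_bigmaxe_seq; apply/hasP; exists 0%N; rewrite ?mem_index_iota.
have max_le K tau (c : \bar R) : (forall nu, (nu <= K)%N -> risk M q nu theta tau <= c)%E ->
    (max_risk M q K theta tau <= c)%E.
  move=> c_ge; rewrite /max_risk big_nat; elim/big_ind: _ => [|x y xc yc|nu /andP[_]].
  - exact: leNye.
  - by rewrite ge_max xc.
  - by rewrite ltnS; exact: c_ge.
have near_H : \forall beta \near (0 : R)^'+, H beta (Tb beta).
  exact: filterS near01.
split=> [nu|]; apply: equiv0_optimal => // eta eta01.
- apply: filterS3 (lower nu _ eta01) (upper _ eta01) (nu_kstar nu).
  by move=> beta lo up nuk; split=> //; exact: up.
- apply: filterS2 (lower 0%N _ eta01) (upper _ eta01) => beta lo up; split.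
    by move=> tau Htau; apply: max_ge; exact: lo.
  exact: max_le.
Unshelve. all: by end_near. Qed.
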